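(* Let $\gamma_0:\mathbb{R}\to\mathbb{R}^3$ be a smooth curve parametrized by arc-length, $g_0$ a p-frame along $\gamma_0$, and $r_1,r_2$ the corresponding principal curvatures. Let $\phi_0\in SU(2)$ be such that $g_0(0)=\mathrm{Ad}(\phi_0)[\delta]$. Suppose $q:\mathbb{R}^2\to\mathbb{C}$ is a smooth solution of the NLS $q_t=\frac{i}{2}(q_{xx}+2|q|^2q)$ with $q(\cdot,0)=\frac12(r_1+ir_2)$. Let $E(x,t,\lambda)$ be the frame of $q$ with $E(0,0,\lambda)=\phi_0$ for all $\lambda\in\mathbb C$, and let $\alpha=\frac{\partial E}{\partial\lambda}E^{-1}\big|_{\lambda=0}$, an $su(2)\simeq\mathbb{R}^3$-valued map. Then $\gamma(x,t)=\alpha(x,t)+\gamma_0(0)$ is the solution of $$\gamma_t=\tfrac12\gamma_x\times\gamma_{xx},\qquad \gamma(x,0)=\gamma_0(x).$$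
   Context: Let $a=\mathrm{diag}(i,-i)$, $b=\begin{pmatrix} 0 & 1 \\ -1 & 0 \end{pmatrix}$, $c=\begin{pmatrix} 0 & i \\ i & 0 \end{pmatrix}$. Identify $su(2)$ with Euclidean $\mathbb{R}^3$ by $xa+yb+zc\mapsto(x,y,z)^t$; the inner product is $(X,Y)=-\frac12\mathrm{tr}(XY)$ and the cross product is $X\times Y=\frac12[X,Y]$. Set $\delta=(a,-c,b)$, and for $\phi\in SU(2)$ let $\mathrm{Ad}(\phi)[\delta]=(\phi a\phi^{-1},-\phi c\phi^{-1},\phi b\phi^{-1})\in SO(3)$, where each column is the element of $su(2)$ written in the coordinates $(x,y,z)^t$ of the identification above. A p-frame along an arc-length parametrized curve $\gamma_0$ in $\mathbb{R}^3$ is a smooth $g_0=(e_0,e_1,e_2):\mathbb{R}\to SO(3)$ with $e_0=(\gamma_0)_x$ and $g_0^{-1}(g_0)_x=\begin{pmatrix} 0 & -r_1 & -r_2 \\ {r_1} & 0 & 0 \\ {r_2} & 0 & 0 \end{pmatrix}$; $r_1,r_2$ are the corresponding principal curvatures. For a solution $q$ of the NLS put $u=\begin{pmatrix} 0 & q \\ -\bar q & 0 \end{pmatrix}$ and $Q_{-1}(u)=\frac{i}{2}\begin{pmatrix} -|q|^2 & q_x \\ \bar q_x & |q|^2 \end{pmatrix}$. A frame of $q$ is an invertible-matrix-valued solution $E(x,t,\lambda)$ of $E^{-1}E_x=a\lambda+u$, $E^{-1}E_t=a\lambda^2+u\lambda+Q_{-1}(u)$ satisfying $E(x,t,\bar\lambda)^*E(x,t,\lambda)=I_2$.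 *)

(* Defs.v *)
From HB Require Import structures.
From mathcomp Require Import all_boot all_order all_algebra.
From mathcomp Require Import all_classical all_reals all_analysis.
From mathcomp Require Import complex ring lra.

Set Implicit Arguments.
Unset Strict Implicit.
Unset Printing Implicit Defensive.

Import Order.TTheory GRing.Theory Num.Theory.
Import numFieldNormedType.Exports.

Local Open Scope classical_set_scope.
Local Open Scope ring_scope.
Local Open Scope complex_scope.
Local Open Scope sesquilinear_scope.

Definition mx_of_rows (K : nmodType) (m n : nat) (s : seq (seq K)) :
    'M[K]_(m, n) :=
  \matrix_(i, j) (nth [::] s i)`_j.

Definition smooth1 (R : realType) (V : normedModType R) (f : R -> V) : Prop :=
  forall n x, derivable (derive1n n f) x 1.

Definition dx (R : realType) (V : normedModType R) (f : R -> R -> V) :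
    R -> R -> V :=
  fun x t => derive1 (fun s => f s t) x.

Definition dt (R : realType) (V : normedModType R) (f : R -> R -> V) :
    R -> R -> V :=
  fun x t => derive1 (fun s => f x s) t.

Fixpoint Ck2 (R : realType) (V : normedModType R) (n : nat)
    (f : R -> R -> V) : Prop :=
  continuous (fun p : R * R => f p.1 p.2) /\
  (if n is m.+1 then
     [/\ forall x t, derivable (fun s => f s t) x 1,
         forall x t, derivable (fun s => f x s) t 1,
         Ck2 m (dx f) & Ck2 m (dt f)]
   else True).

Definition smooth2 (R : realType) (V : normedModType R) (f : R -> R -> V) :
    Prop :=
  forall n, Ck2 n f.

(* [R[i]] carries no normed module structure over [R] in the library, so
   derivatives in a real variable are taken on real and imaginary parts. *)

Definition cderivable (R : realType) (f : R -> R[i]) (x : R) : Prop :=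
  derivable (fun s => complex.Re (f s)) x 1 /\
  derivable (fun s => complex.Im (f s)) x 1.

Definition cderive (R : realType) (f : R -> R[i]) (x : R) : R[i] :=
  derive1 (fun s => complex.Re (f s)) x +i*
  derive1 (fun s => complex.Im (f s)) x.

Definition cdx (R : realType) (f : R -> R -> R[i]) : R -> R -> R[i] :=
  fun x t => cderive (fun s => f s t) x.

Definition cdt (R : realType) (f : R -> R -> R[i]) : R -> R -> R[i] :=
  fun x t => cderive (fun s => f x s) t.

Definition csmooth2 (R : realType) (f : R -> R -> R[i]) : Prop :=
  smooth2 (fun x t => complex.Re (f x t)) /\
  smooth2 (fun x t => complex.Im (f x t)).

Definition mxcderivable (R : realType) (m n : nat) (M : R -> 'M[R[i]]_(m, n))
    (x : R) : Prop :=
  forall i j, cderivable (fun s => M s i j) x.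

Definition mxcderive (R : realType) (m n : nat) (M : R -> 'M[R[i]]_(m, n))
    (x : R) : 'M[R[i]]_(m, n) :=
  \matrix_(i, j) cderive (fun s => M s i j) x.

Definition SU2 (R : realType) (A : 'M[R[i]]_2) : Prop :=
  A ^t* *m A = 1%:M /\ \det A = 1.

Definition su2 (R : realType) (X : 'M[R[i]]_2) : Prop :=
  X ^t* = - X /\ \tr X = 0.

Definition su2_a (R : realType) : 'M[R[i]]_2 :=
  mx_of_rows 2 2 [:: [:: 'i%C; 0]; [:: 0; - 'i%C]].

Definition su2_b (R : realType) : 'M[R[i]]_2 :=
  mx_of_rows 2 2 [:: [:: 0; 1]; [:: -1; 0]].

Definition su2_c (R : realType) : 'M[R[i]]_2 :=
  mx_of_rows 2 2 [:: [:: 0; 'i%C]; [:: 'i%C; 0]].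

Definition su2_of_vec (R : realType) (v : 'cV[R]_3) : 'M[R[i]]_2 :=
  (v 0 0)%:C *: su2_a R + (v 1 0)%:C *: su2_b R + (v 2 0)%:C *: su2_c R.

(* Meaningful on [su2] only, where it inverts [su2_of_vec]. *)
Definition vec_of_su2 (R : realType) (X : 'M[R[i]]_2) : 'cV[R]_3 :=
  \col_k [:: complex.Im (X 0 0); complex.Re (X 0 1); complex.Im (X 0 1)]`_k.

Lemma su2_of_vecE (R : realType) (v : 'cV[R]_3) :
  su2_of_vec v =
  mx_of_rows 2 2 [:: [:: 0 +i* v 0 0; v 1 0 +i* v 2 0];
                     [:: - v 1 0 +i* v 2 0; 0 -i* v 0 0]].
Proof.
apply/matrixP => i j; rewrite /su2_of_vec /su2_a /su2_b /su2_c !mxE.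
by case: i j => -[|[|//]] lti [] [|[|//]] ltj /=; apply/eqP;
  rewrite eq_complex /= ?(mulr0, mulr1, mul0r, mul1r, mulrN, addr0, add0r,
    subr0, oppr0, mulN1r, mulrN1, eqxx).
Qed.

Lemma vec_of_su2E (R : realType) (a b c d : R[i]) :
  vec_of_su2 (mx_of_rows 2 2 [:: [:: a; b]; [:: c; d]]) =
  \col_k [:: complex.Im a; complex.Re b; complex.Im b]`_k.
Proof. by rewrite /vec_of_su2 !mxE. Qed.

Lemma su2_of_vecK (R : realType) :
  cancel (@su2_of_vec R) (@vec_of_su2 R).
Proof.
move=> v; rewrite su2_of_vecE vec_of_su2E; apply/matrixP => k j.
rewrite ord1 !mxE /=.
by case: k => -[|[|[|//]]] ltk /=; congr (v _ _); apply: val_inj.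
Qed.

Lemma su2_of_vecP (R : realType) (v : 'cV[R]_3) : su2 (su2_of_vec v).
Proof.
rewrite su2_of_vecE; split; last first.
  by rewrite /mxtrace !big_ord_recl big_ord0 !mxE /= addr0; apply/eqP;
    rewrite eq_complex /= addr0 subrr eqxx.
apply/matrixP => i j; rewrite !mxE.
by case: i j => -[|[|//]] lti [] [|[|//]] ltj /=; apply/eqP;
  rewrite eq_complex /= ?(opprK, oppr0) !eqxx.
Qed.

Lemma vec_of_su2K (R : realType) (X : 'M[R[i]]_2) :
  su2 X -> su2_of_vec (vec_of_su2 X) = X.
Proof.
case=> hX trX; rewrite su2_of_vecE !mxE /=.
have h i j : ((X j i)^*)%C = - X i j.
  by have /matrixP/(_ i j) := hX; rewrite !mxE.
have h00 : complex.Re (X 0 0) = 0.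
  have /eqP := h 0 0; rewrite eq_complex => /andP[].
  by case: (X 0 0) => u v /= /eqP e _; lra.
have h10 : X 1 0 = - ((X 0 1)^*)%C by rewrite h opprK.
have h11 : X 1 1 = - X 0 0.
  by move: trX; rewrite /mxtrace !big_ord_recl big_ord0 addr0 => /eqP;
    rewrite addr_eq0 => /eqP ->; rewrite opprK; congr (X _ _); apply: val_inj.
apply/matrixP => i j; rewrite !mxE.
have [-> | ->] : i = 0 \/ i = 1 by case: i => -[|[|//]] lti; [left|right];
  apply: val_inj.
all: have [-> | ->] : j = 0 \/ j = 1 by case: j => -[|[|//]] ltj; [left|right];
  apply: val_inj.
all: rewrite ?h10 ?h11; apply/eqP; rewrite eq_complex /=.
all: rewrite ?h00 ?eqxx //.
- by case: (X 0 1) => u v /=; rewrite opprK !eqxx.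
- by case: (X 0 0) h00 => u v /= ->; rewrite oppr0 !eqxx.
Qed.

Definition cross (R : realType) (v w : 'cV[R]_3) : 'cV[R]_3 :=
  let X := su2_of_vec v in let Y := su2_of_vec w in
  vec_of_su2 (2^-1 *: (X *m Y - Y *m X)).

Lemma crossE (R : realType) (v w : 'cV[R]_3) :
  cross v w = \col_k [:: v 1 0 * w 2 0 - v 2 0 * w 1 0;
                         v 2 0 * w 0 0 - v 0 0 * w 2 0;
                         v 0 0 * w 1 0 - v 1 0 * w 0 0]`_k.
Proof.
rewrite /cross /= !su2_of_vecE; apply/matrixP => k j; rewrite !mxE.
have e2 : (2^-1 : R[i]) = (2^-1)%:C by rewrite fmorphV rmorphMn.
rewrite e2 !big_ord_recl !big_ord0 !mxE /=.
by case: k => -[|[|[|//]]] ltk /=; field.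
Qed.

Definition delta (R : realType) : seq 'M[R[i]]_2 :=
  [:: su2_a R; - su2_c R; su2_b R].

Definition Ad_delta (R : realType) (phi : 'M[R[i]]_2) : 'M[R]_3 :=
  \matrix_(k, j) vec_of_su2 (phi *m (delta R)`_j *m invmx phi) k 0.

(* The library norm on matrices is the sup norm. *)
Definition enorm (R : realType) (n : nat) (v : 'cV[R]_n) : R :=
  Num.sqrt (\sum_k v k 0 ^+ 2).

Definition arclength_curve (R : realType) (gamma0 : R -> 'cV[R]_3) : Prop :=
  smooth1 gamma0 /\ forall x, enorm (derive1 gamma0 x) = 1.

Definition SO3 (R : realType) (g : 'M[R]_3) : Prop :=
  g^T *m g = 1%:M /\ \det g = 1.

Definition p_frame (R : realType) (gamma0 : R -> 'cV[R]_3)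
    (g0 : R -> 'M[R]_3) (r1 r2 : R -> R) : Prop :=
  [/\ smooth1 g0,
      forall x, SO3 (g0 x),
      forall x, col 0 (g0 x) = derive1 gamma0 x &
      forall x, invmx (g0 x) *m derive1 g0 x =
        mx_of_rows 3 3 [:: [:: 0; - r1 x; - r2 x];
                           [:: r1 x; 0; 0];
                           [:: r2 x; 0; 0]] ].

Definition NLS_solution (R : realType) (q : R -> R -> R[i]) : Prop :=
  csmooth2 q /\
  forall x t, cdt q x t =
    'i%C / 2 * (cdx (cdx q) x t + 2 * `|q x t| ^+ 2 * q x t).

Definition lax_u (R : realType) (q : R -> R -> R[i]) (x t : R) : 'M[R[i]]_2 :=
  mx_of_rows 2 2 [:: [:: 0; q x t]; [:: - (q x t)^*%C; 0]].

Definition lax_Q (R : realType) (q : R -> R -> R[i]) (x t : R) : 'M[R[i]]_2 :=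
  ('i%C / 2) *: mx_of_rows 2 2
    [:: [:: - `|q x t| ^+ 2; cdx q x t];
        [:: (cdx q x t)^*%C; `|q x t| ^+ 2]].

Definition NLS_frame (R : realType) (q : R -> R -> R[i])
    (E : R -> R -> R[i] -> 'M[R[i]]_2) : Prop :=
  [/\ forall x t l, E x t l \in unitmx,
      forall x t l, mxcderivable (fun s => E s t l) x /\
                    mxcderivable (fun s => E x s l) t,
      forall x t l, invmx (E x t l) *m mxcderive (fun s => E s t l) x =
                    l *: su2_a R + lax_u q x t,
      forall x t l, invmx (E x t l) *m mxcderive (fun s => E x s l) t =
                    l ^+ 2 *: su2_a R + l *: lax_u q x t + lax_Q q x t &
      forall x t l, (E x t l^*%C) ^t* *m E x t l = 1%:M].

(* The derivative in the spectral parameter is the complex one, in [R[i]]. *)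
Definition frame_alpha (R : realType) (E : R -> R -> R[i] -> 'M[R[i]]_2)
    (x t : R) : 'M[R[i]]_2 :=
  derive1 (E x t) 0 *m invmx (E x t 0).

Definition VFE_solution (R : realType) (gamma : R -> R -> 'cV[R]_3)
    (gamma0 : R -> 'cV[R]_3) : Prop :=
  [/\ smooth2 gamma,
      forall x t, dt gamma x t =
        2^-1 *: cross (dx gamma x t) (dx (dx gamma) x t) &
      forall x, gamma x 0 = gamma0 x].

(* Main.v *)
Require Import Defs.
From HB Require Import structures.
From mathcomp Require Import all_boot all_order all_algebra.
From mathcomp Require Import all_classical all_reals all_analysis.
From mathcomp Require Import complex ring lra.

(* Put F = E(.,.,0), a unitary matrix, and W_l = E(.,.,l) F^-1. The two equations
   of the frame give
     (W_l)_x = W_l (l F a F^-1),   (W_l)_t = W_l (l F u F^-1 + l^2 F a F^-1),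
   so W_l = 1 + l alpha + O(l^2), by Gronwall along the axes starting from
   W_l(0,0) = 1, with alpha_x = F a F^-1 and alpha_t = F u F^-1. Then
   alpha_xx = F [u,a] F^-1, and [a,[u,a]] = 4u turns (1/2) alpha_x x alpha_xx into
   F u F^-1 = alpha_t. At t = 0, both g_0 and Ad(F)[delta] solve g_x = g M with the
   same skew matrix M of principal curvatures and agree at x = 0, so they coincide;
   their first columns are the derivatives of gamma_0 and of alpha(.,0). The frame
   is only assumed separately differentiable at each l: unitarity bounds the partial
   derivatives of F locally, so F is jointly continuous, and smoothness follows by
   bootstrapping F_x = F u, F_t = F Q. *)

Set Implicit Arguments.
Unset Strict Implicit.
Unset Printing Implicit Defensive.

Import Order.TTheory GRing.Theory Num.Theory.
Import numFieldNormedType.Exports.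

Local Open Scope classical_set_scope.
Local Open Scope ring_scope.
Local Open Scope complex_scope.

(** * Calculus of complex-valued and matrix-valued functions of a real variable *)

Definition is_cderive (R : realType) (x : R) (f : R -> R[i]) (d : R[i]) :=
  is_derive x 1 (fun s => complex.Re (f s)) (complex.Re d) /\
  is_derive x 1 (fun s => complex.Im (f s)) (complex.Im d).

Definition is_mxcderive (R : realType) (m n : nat) (x : R)
    (M : R -> 'M[R[i]]_(m, n)) (D : 'M[R[i]]_(m, n)) :=
  forall i j, is_cderive x (fun s => M s i j) (D i j).

Section ComplexCalculus.
Context {R : realType}.
Implicit Types (x : R) (f g : R -> R[i]) (c d : R[i]).

Lemma is_cderiveP x f : cderivable f x -> is_cderive x f (cderive f x).
Proof. by case=> h1 h2; split; rewrite /= derive1E; exact: derivableP. Qed.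

Lemma is_cderive_cst x c : is_cderive x (fun=> c) 0.
Proof. by split; exact: is_derive_cst. Qed.

Lemma ReD c d : complex.Re (c + d) = complex.Re c + complex.Re d.
Proof. by case: c => ? ?; case: d. Qed.

Lemma ImD c d : complex.Im (c + d) = complex.Im c + complex.Im d.
Proof. by case: c => ? ?; case: d. Qed.

Lemma is_cderiveD x f g c d :
  is_cderive x f c -> is_cderive x g d ->
  is_cderive x (fun s => f s + g s) (c + d).
Proof.
move=> [f1 f2] [g1 g2]; split.
- rewrite ReD [X in is_derive _ _ X _](_ : _ =
    (fun s => complex.Re (f s)) + (fun s => complex.Re (g s)));
    first exact: is_deriveD.
  by apply/funext => s; rewrite ReD.
- rewrite ImD [X in is_derive _ _ X _](_ : _ =
    (fun s => complex.Im (f s)) + (fun s => complex.Im (g s)));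
    first exact: is_deriveD.
  by apply/funext => s; rewrite ImD.
Qed.

Lemma is_cderive_conj x f c :
  is_cderive x f c -> is_cderive x (fun s => (f s)^*) c^*.
Proof.
move=> [f1 f2]; split.
- rewrite [X in is_derive _ _ X _](_ : _ = (fun s => complex.Re (f s))).
    by case: c f1 {f2}.
  by apply/funext => s; case: (f s).
- rewrite [X in is_derive _ _ X _](_ : _ = - (fun s => complex.Im (f s))).
    by case: c f2 {f1} => a b /= f2; exact: is_deriveN.
  by apply/funext => s; rewrite fctE; case: (f s).
Qed.

Lemma ReM c d : complex.Re (c * d) =
  complex.Re c * complex.Re d - complex.Im c * complex.Im d.
Proof. by case: c => ? ?; case: d. Qed.

Lemma ImM c d : complex.Im (c * d) =
  complex.Re c * complex.Im d + complex.Im c * complex.Re d.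
Proof. by case: c => ? ?; case: d. Qed.

Lemma is_cderiveM x f g c d :
  is_cderive x f c -> is_cderive x g d ->
  is_cderive x (fun s => f s * g s) (c * g x + f x * d).
Proof.
move=> [f1 f2] [g1 g2]; split.
- rewrite [X in is_derive _ _ X _](_ : _ =
    ((fun s => complex.Re (f s)) * (fun s => complex.Re (g s)) -
    (fun s => complex.Im (f s)) * (fun s => complex.Im (g s))) :> (R -> R)).
    by apply: is_derive_eq; rewrite ReD /= !ReM /GRing.scale /=; ring.
  by apply/funext => s; rewrite ReM.
- rewrite [X in is_derive _ _ X _](_ : _ =
    ((fun s => complex.Re (f s)) * (fun s => complex.Im (g s)) +
    (fun s => complex.Im (f s)) * (fun s => complex.Re (g s))) :> (R -> R)).
    by apply: is_derive_eq; rewrite ImD /= !ImM /GRing.scale /=; ring.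
  by apply/funext => s; rewrite ImM.
Qed.

Lemma is_cderive_sum (I : Type) (r : seq I) x (F : I -> R -> R[i])
    (D : I -> R[i]) :
  (forall k, is_cderive x (F k) (D k)) ->
  is_cderive x (fun s => \sum_(k <- r) F k s) (\sum_(k <- r) D k).
Proof.
move=> FD; elim: r => [|k r IH].
  rewrite big_nil (_ : (fun _ => _) = (fun=> 0)) ; first exact: is_cderive_cst.
  by apply/funext => s; rewrite big_nil.
rewrite big_cons (_ : (fun _ => _) = (fun s => F k s + \sum_(j <- r) F j s)).
  exact: is_cderiveD.
by apply/funext => s; rewrite big_cons.
Qed.

Lemma is_mxcderiveP m n x (M : R -> 'M[R[i]]_(m, n)) :
  mxcderivable M x -> is_mxcderive x M (mxcderive M x).
Proof. by move=> h i j; rewrite mxE; exact: is_cderiveP. Qed.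

Lemma is_mxcderive_eq m n x (M : R -> 'M[R[i]]_(m, n)) D D' :
  is_mxcderive x M D -> D = D' -> is_mxcderive x M D'.
Proof. by move=> ? <-. Qed.

Lemma is_mxcderive_cst m n x (M : 'M[R[i]]_(m, n)) :
  is_mxcderive x (fun=> M) 0.
Proof. by move=> i j; rewrite mxE; exact: is_cderive_cst. Qed.

Lemma is_mxcderiveD m n x (M N : R -> 'M[R[i]]_(m, n)) D D' :
  is_mxcderive x M D -> is_mxcderive x N D' ->
  is_mxcderive x (fun s => M s + N s) (D + D').
Proof.
move=> hM hN i j; rewrite mxE (_ : (fun _ => _) = fun s => M s i j + N s i j).
  exact: is_cderiveD.
by apply/funext => s; rewrite mxE.
Qed.

Lemma is_mxcderiveM m n p x (M : R -> 'M[R[i]]_(m, n))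
    (N : R -> 'M[R[i]]_(n, p)) D D' :
  is_mxcderive x M D -> is_mxcderive x N D' ->
  is_mxcderive x (fun s => M s *m N s) (D *m N x + M x *m D').
Proof.
move=> hM hN i j.
rewrite (_ : (fun _ => _) = fun s => \sum_k M s i k * N s k j); last first.
  by apply/funext => s; rewrite mxE.
rewrite !mxE -big_split /=; apply: is_cderive_sum => k; exact: is_cderiveM.
Qed.

Lemma is_mxcderiveZ m n x c (M : R -> 'M[R[i]]_(m, n)) D :
  is_mxcderive x M D -> is_mxcderive x (fun s => c *: M s) (c *: D).
Proof.
move=> hM i j; rewrite mxE (_ : (fun _ => _) = fun s => c * M s i j).
  by rewrite -[_ * _]add0r -[0](mul0r (M x i j));
    apply: is_cderiveM => //; exact: is_cderive_cst.
by apply/funext => s; rewrite mxE.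
Qed.

Local Open Scope sesquilinear_scope.
Lemma is_mxcderive_adj m n x (M : R -> 'M[R[i]]_(m, n)) D :
  is_mxcderive x M D -> is_mxcderive x (fun s => (M s)^t*) (D^t*).
Proof.
move=> hM i j; rewrite !mxE (_ : (fun _ => _) = fun s => (M s j i)^*).
  exact: is_cderive_conj.
by apply/funext => s; rewrite !mxE.
Qed.
Local Close Scope sesquilinear_scope.

(** The squared modulus is kept real-valued and polynomial in the two parts, so it can be
    differentiated and compared in [R]. *)
Definition sqmod c : R := complex.Re c ^+ 2 + complex.Im c ^+ 2.

Lemma sqmod_ge0 c : 0 <= sqmod c.
Proof. by rewrite addr_ge0 ?sqr_ge0. Qed.

Lemma sqmodM c d : sqmod (c * d) = sqmod c * sqmod d.
Proof. by rewrite /sqmod ReM ImM; ring. Qed.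

Lemma sqmodD c d : sqmod (c + d) <= 2 * (sqmod c + sqmod d).
Proof.
rewrite /sqmod ReD ImD -subr_ge0.
set a := complex.Re _; set b := complex.Im _;
  set e := complex.Re _; set h := complex.Im _.
(* Parallelogram law: the gap between the two sides is the squared modulus of c - d. *)
by rewrite (_ : _ - _ = (a - e) ^+ 2 + (b - h) ^+ 2) ?addr_ge0 ?sqr_ge0//; ring.
Qed.

(** The squared Frobenius norm. Unlike the norm itself it is differentiable along every
    differentiable path of matrices, including at zero, as the Gronwall argument requires. *)
Definition frob2 m n (M : 'M[R[i]]_(m, n)) : R :=
  \sum_i \sum_j sqmod (M i j).

Lemma frob2_ge0 m n (M : 'M[R[i]]_(m, n)) : 0 <= frob2 M.
Proof. by do 2![apply: sumr_ge0 => ? _]; exact: sqmod_ge0. Qed.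

Lemma frob2_ge m n (M : 'M[R[i]]_(m, n)) i j : sqmod (M i j) <= frob2 M.
Proof.
rewrite /frob2 (bigD1 i) //= (bigD1 j) //= -addrA lerDl.
by rewrite addr_ge0 //; do ?[apply: sumr_ge0 => ? _]; exact: sqmod_ge0.
Qed.

Lemma frob2D m n (M N : 'M[R[i]]_(m, n)) :
  frob2 (M + N) <= 2 * (frob2 M + frob2 N).
Proof.
rewrite /frob2 -big_split mulr_sumr /=; apply: ler_sum => i _.
rewrite -big_split mulr_sumr /=; apply: ler_sum => j _.
by rewrite mxE; exact: sqmodD.
Qed.

Lemma frob2Z m n c (M : 'M[R[i]]_(m, n)) :
  frob2 (c *: M) = sqmod c * frob2 M.
Proof.
rewrite /frob2 mulr_sumr; apply: eq_bigr => i _.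
rewrite mulr_sumr; apply: eq_bigr => j _.
by rewrite mxE sqmodM.
Qed.

(** Each entry of the product has two terms, whence the factor 2 from [sqmodD]. *)
Lemma frob2M (M N : 'M[R[i]]_2) : frob2 (M *m N) <= 2 * (frob2 M * frob2 N).
Proof.
have h i j : sqmod ((M *m N) i j) <= 2 * \sum_k sqmod (M i k) * sqmod (N k j).
  rewrite mxE !big_ord_recl !big_ord0 !addr0 -!sqmodM; exact: sqmodD.
apply: le_trans (_ : \sum_i \sum_j 2 * \sum_k sqmod (M i k) * sqmod (N k j) <= _).
  by do 2![apply: ler_sum => ? _]; exact: h.
rewrite /frob2 !big_ord_recl !big_ord0 !addr0.
set i1 := lift ord0 ord0.
have p i j : 0 <= sqmod (M i j) by exact: sqmod_ge0.
have r i j : 0 <= sqmod (N i j) by exact: sqmod_ge0.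
(* After expansion the gap consists of the products with mismatched inner indices, all
   nonnegative. *)
rewrite -subr_ge0 [X in 0 <= X](_ : _ = 2 * ((sqmod (M 0 0) + sqmod (M i1 0)) *
  (sqmod (N i1 0) + sqmod (N i1 i1)) + (sqmod (M 0 i1) + sqmod (M i1 i1)) *
  (sqmod (N 0 0) + sqmod (N 0 i1)))); last by ring.
by rewrite mulr_ge0 // addr_ge0 // mulr_ge0 // addr_ge0.
Qed.

(** The derivative is twice the real inner product of M and D; Young's inequality bounds it by
    squared norms, which is the shape that Gronwall needs. *)
Lemma is_derive_frob2 m n x (M : R -> 'M[R[i]]_(m, n)) D :
  is_mxcderive x M D ->
  exists2 d, is_derive x 1 (fun s => frob2 (M s)) d &
    `|d| <= frob2 (M x) + frob2 D.
Proof.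
move=> hM.
pose d i j := 2 * (complex.Re (M x i j) * complex.Re (D i j) +
                   complex.Im (M x i j) * complex.Im (D i j)).
exists (\sum_i \sum_j d i j).
  rewrite (_ : (fun s => _) = \sum_i \sum_j (fun s =>
     complex.Re (M s i j) ^+ 2 + complex.Im (M s i j) ^+ 2)); last first.
    apply/funext => s; rewrite fct_sumE; apply: eq_bigr => i _.
    by rewrite fct_sumE.
  apply: is_derive_sum => i; apply: is_derive_sum => j.
  have [h1 h2] := hM i j.
  rewrite [X in is_derive _ _ X _](_ : _ = ((fun s => complex.Re (M s i j)) ^+ 2
     + (fun s => complex.Im (M s i j)) ^+ 2) :> (R -> R)); last first.
    by apply/funext => s; rewrite fctE.
  by apply: is_derive_eq; rewrite /d /GRing.scale /=; ring.
rewrite /frob2 -big_split (le_trans (ler_norm_sum _ _ _)) //=.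
apply: ler_sum => i _; rewrite -big_split (le_trans (ler_norm_sum _ _ _)) //=.
apply: ler_sum => j _; rewrite /d /sqmod.
set a := complex.Re _; set b := complex.Re _.
set c := complex.Im _; set e := complex.Im _.
have := sqr_ge0 (a - b); have := sqr_ge0 (a + b).
have := sqr_ge0 (c - e); have := sqr_ge0 (c + e).
by rewrite ler_norml; move=> *; apply/andP; split; nra.
Qed.

End ComplexCalculus.

(** * Derivatives in the spectral parameter, Gronwall estimates and antiderivatives *)

Lemma derive1_mx_lim (K : numFieldType) (m n : nat) (f : K -> 'M[K]_(m, n))
    (L : 'M[K]_(m, n)) :
  (forall e : K, 0 < e -> exists2 d : K, 0 < d & forall h, h != 0 -> `|h| < d ->
    forall i j, `|(L - h^-1 *: (f h - f 0)) i j| <= e) ->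
  derivable (f : K^o -> 'M[K]_(m, n)) 0 1 /\ derive1 f 0 = L.
Proof.
move=> H.
suff cv : h^-1 *: (f (h + 0) - f 0) @[h --> 0^'] --> L.
  split; last exact/cvg_lim.
  apply/cvg_ex; exists L; apply: cvg_trans cv; apply: near_eq_cvg.
  by near=> h; rewrite /= [h *: 1]mulr1.
apply/cvgrPdist_le => e e0; have [d d0 Hd] := H e e0.
near=> h; rewrite addr0.
set X := L - _; rewrite [X in X <= _](_ : _ = mx_norm X) //.
(* A nonzero matrix norm is attained at some entry, so the entrywise bound suffices. *)
have [->|/mx_norm_neq0[[i j] /= ->]] := eqVneq (mx_norm X) 0.
  exact: ltW.
apply: Hd; first by near: h; exact: nbhs_dnbhs_neq.
by near: h; exact: dnbhs0_lt.
Unshelve. all: by end_near. Qed.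

Section RealAnalysis.
Context {R : realType}.

Lemma derivable_itv_continuous (f : R -> R) (a b s t : R) :
  s \in `]a, b[ -> t \in `]a, b[ ->
  (forall x, x \in `]a, b[ -> derivable f x 1) ->
  {within `[s, t], continuous f}.
Proof.
rewrite !in_itv /= => /andP[as_ sb] /andP[at_ tb] df.
apply: derivable_within_continuous => x; rewrite in_itv /= => /andP[sx xt].
by apply: df; rewrite in_itv /= (lt_le_trans as_ sx) (le_lt_trans xt tb).
Qed.

(** The function N(x) exp(K x) has derivative (N' + K N) exp(K x), which is nonnegative, so it is
    nondecreasing by the mean value theorem. *)
Lemma gronwall_le (N : R -> R) (a b K u v : R) :
  (forall x, x \in `]a, b[ ->
    exists2 d, is_derive x 1 N d & `|d| <= K * N x) ->
  u \in `]a, b[ -> v \in `]a, b[ -> u <= v -> N u <= N v * expR (K * (v - u)).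
Proof.
move=> dN uab vab uv.
pose g x := N x * expR (K * x).
have dg x : x \in `]a, b[ -> exists2 d, is_derive x 1 g d & 0 <= d.
  move=> /dN[d dNx dle]; exists ((d + K * N x) * expR (K * x)); last first.
    by rewrite mulr_ge0 ?expR_ge0 //; move: dle; rewrite ler_norml; lra.
  have dk : is_derive x 1 (fun y => K * y) K.
    rewrite -[X in is_derive _ _ _ X]mulr1.
    exact: (@is_deriveZ _ _ _ id K x 1 1).
  have de : is_derive x 1 (fun y => expR (K * y)) (expR (K * x) * K).
    exact: (@is_derive1_comp _ expR (fun y => K * y)).
  apply: is_derive_eq (@is_deriveM _ _ N (fun y => expR (K * y)) x 1 d _ dNx de) _.
  by rewrite /GRing.scale /=; ring.
have guv : g u <= g v.
  have [||c cuv gE] := @MVT_segment R g (fun x => 'D_1 g x) u v uv.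
  - move=> x; rewrite in_itv /= => /andP[ux xv]; apply: derivableP.
    have /dg[d []//] : x \in `]a, b[.
    move: uab vab; rewrite !in_itv /= => /andP[au _] /andP[_ vb].
    by rewrite (lt_trans au) // (lt_trans xv).
  - by apply: (derivable_itv_continuous uab vab) => x /dg[d []].
  - have /dg[d [_ dE] d0] : c \in `]a, b[.
      move: uab vab cuv; rewrite !in_itv /= => /andP[au _] /andP[_ vb] /andP[uc cv].
      by rewrite (lt_le_trans au) // (le_lt_trans cv).
    by rewrite -subr_ge0 gE dE mulr_ge0 // subr_ge0.
rewrite -(ler_pM2r (expR_gt0 (K * u))) -mulrA -expRD.
by rewrite (_ : K * (v - u) + K * u = K * v) //; ring.
Qed.

(** For t to the left of s this is [gronwall_le]; the other case follows by the reflection y to -y,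
    under which the hypothesis is invariant. *)
Lemma gronwall (N : R -> R) (a b K s t : R) :
  (forall x, x \in `]a, b[ ->
    exists2 d, is_derive x 1 N d & `|d| <= K * N x) ->
  s \in `]a, b[ -> t \in `]a, b[ -> N t <= N s * expR (K * `|t - s|).
Proof.
move=> dN sab tab; have [ts|/ltW st] := leP t s.
  by rewrite distrC ger0_norm ?subr_ge0 //; exact: gronwall_le dN tab sab ts.
have opp x : (x \in `]- b, - a[) = (- x \in `]a, b[).
  by rewrite !in_itv /= ltrNr ltrNl andbC.
have dNo x : x \in `]- b, - a[ ->
    exists2 d, is_derive x 1 (fun y => N (- y)) d & `|d| <= K * N (- x).
  rewrite opp => /dN[d dNx dle]; exists (d * - 1); last by rewrite mulrN1 normrN.
  exact: (@is_derive1_comp _ N (fun y => - y)).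
have := @gronwall_le _ _ _ K (- t) (- s) dNo; rewrite !opp !opprK.
move=> /(_ tab sab); rewrite lerN2 => /(_ st).
by rewrite ger0_norm ?subr_ge0 // (addrC t).
Qed.

(** The integral from the left end [a], shifted by a constant so as to take the value y at s. *)
Lemma antiderivative (f : R -> R) (a b s y : R) :
  continuous f -> s \in `]a, b[ ->
  exists F : R -> R, F s = y /\ forall x, x \in `]a, b[ -> is_derive x 1 F (f x).
Proof.
move=> cf sab.
pose I x := (\int[@lebesgue_measure R]_(t in [set` `[a, x]]) f t)%R.
exists (fun x => I x + (y - I s)); split; first by rewrite addrC subrK.
move=> x; rewrite in_itv /= => /andP[ax xb].
have fi : lebesgue_measure.-integrable `[a, b] (EFin \o f).
  apply: continuous_compact_integrable; first exact: segment_compact.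
  exact: continuous_subspaceT.
have [] := continuous_FTC1_closed xb fi ax (cf x).
rewrite derive1E => dI eI; rewrite -[f x]addr0 -eI.
apply: (@is_deriveD _ _ _ I (fun=> y - I s)); first exact: derivableP.
Qed.

Lemma sqmod_normE (z : R[i]) : (sqmod z)%:C = `|z| ^+ 2.
Proof. exact: add_Re2_Im2. Qed.

(** In squared norms the remainder is of order |h|^4; division by h leaves an error whose square is
    at most C |h|^2. *)
Lemma derive1_mx_quad (f : R[i] -> 'M[R[i]]_2) (L : 'M[R[i]]_2) (C : R) :
  (forall h, sqmod h <= 1 -> frob2 (f h - f 0 - h *: L) <= C * sqmod h ^+ 2) ->
  derivable (f : R[i]^o -> 'M[R[i]]_2) 0 1 /\ derive1 f 0 = L.
Proof.
move=> H; apply: derive1_mx_lim => e e0.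
(* A positive element of [R[i]] is real, so the tolerance can be handled as a real number r. *)
have eE : e = (complex.Re e)%:C.
  by move: e0; case: e => a b; rewrite ltcE /= => /andP[/eqP -> _].
have r0 : 0 < complex.Re e by move: e0; rewrite eE ltcR.
set r := complex.Re e in eE r0.
have C0 : 0 < `|C| + 1 by rewrite ltr_wpDl.
(* A bound on the squared modulus of h: the 1 keeps h in the range of the hypothesis, and the
   quotient gives (|C| + 1) d <= r^2. As C may have either sign, |C| + 1 serves as a positive
   substitute. *)
pose d := Num.min 1 (r ^+ 2 / (`|C| + 1)).
have d0 : 0 < d by rewrite lt_min ltr01 divr_gt0 // exprn_gt0.
exists (Num.sqrt d)%:C; first by rewrite ltcR sqrtr_gt0.
move=> h h0 hd i j.
have {}hd : sqmod h <= d.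
  rewrite -lecR sqmod_normE -[d]sqr_sqrtr ?(ltW d0) // rmorphXn.
  have sd0 : 0 <= (Num.sqrt d)%:C by rewrite lecR sqrtr_ge0.
  by rewrite ler_pXn2r ?nnegrE // ltW.
have sh0 : 0 < sqmod h.
  by rewrite -ltcR sqmod_normE exprn_gt0 // normr_gt0.
rewrite -(@ler_pXn2r _ 2) ?nnegrE ?(ltW e0) //.
rewrite -sqmod_normE eE -rmorphXn lecR.
have -> : L - h^-1 *: (f h - f 0) = - h^-1 *: (f h - f 0 - h *: L).
  by rewrite [RHS]scalerBr scalerA mulNr mulVf // scaleNr scaleN1r opprK addrC.
apply: le_trans (frob2_ge _ _ _) _.
have shV : sqmod (- h^-1) = (sqmod h)^-1.
  apply: (mulfI (lt0r_neq0 sh0)); rewrite (mulfV (lt0r_neq0 sh0)) -sqmodM mulrN mulfV //.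
  by rewrite /sqmod /=; ring.
rewrite frob2Z shV ler_pdivrMl //.
have /H : sqmod h <= 1 by move: hd; rewrite le_min => /andP[].
move=> /le_trans -> //; rewrite expr2 mulrA mulrC -subr_ge0 -mulrBr.
rewrite pmulr_rge0 // subr_ge0.
move: hd; rewrite le_min ler_pdivlMr // => /andP[_]; apply: le_trans.
rewrite mulrC ler_pM2l //; move: (ler_norm C); lra.
Qed.
End RealAnalysis.

(** * First-order expansion in the spectral parameter *)

Section SpectralExpansion.
Context {R : realType}.
Implicit Types (x s t a b : R) (p v : R -> 'cV[R]_3).

(* [W l = 1 + l P + O(l^2)] as [l] tends to 0; [frob2] and [sqmod] are squared norms. *)
Definition quad_at (W : R[i] -> 'M[R[i]]_2) (P : 'M[R[i]]_2) :=
  exists C, forall l, sqmod l <= 1 ->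
    frob2 (W l - 1%:M - l *: P) <= C * sqmod l ^+ 2.

Lemma frob2_itv_bounded (M : R -> 'M[R[i]]_2) a b :
  a <= b -> (forall x, x \in `[a, b] -> exists D, is_mxcderive x M D) ->
  exists2 K, 0 <= K & forall x, x \in `[a, b] -> frob2 (M x) <= K.
Proof.
move=> ab dM.
have [|c _ Hc] := @EVT_max R (fun x => frob2 (M x)) a b ab.
  apply: derivable_within_continuous => x /dM[D /is_derive_frob2[d [? _] _]] //.
by exists (frob2 (M c)) => //; exact: frob2_ge0.
Qed.

(** The remainder Y = W - 1 - l P satisfies Y' = Y (l A + l^2 B) + l^2 (P A + B + l P B). Adding
    |l|^4 to [frob2 Y] absorbs the inhomogeneous term, and Gronwall applies with a constant uniform
    in |l| <= 1. *)
Lemma quad_at_transport (W : R -> R[i] -> 'M[R[i]]_2)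
    (P A B : R -> 'M[R[i]]_2) a b s t :
  s \in `]a, b[ -> t \in `]a, b[ ->
  (forall x l, x \in `[a, b] -> is_mxcderive x (fun y => W y l)
     (W x l *m (l *: A x + l ^+ 2 *: B x))) ->
  (forall x, x \in `[a, b] -> is_mxcderive x P (A x)) ->
  (forall x, x \in `[a, b] -> exists D, is_mxcderive x A D) ->
  (forall x, x \in `[a, b] -> exists D, is_mxcderive x B D) ->
  quad_at (W s) (P s) -> quad_at (W t) (P t).
Proof.
move=> sab tab dW dP dA dB [C HC].
have ab : a <= b.
  by move: sab; rewrite in_itv /= => /andP[h1 h2]; apply/ltW/(lt_trans h1).
have oc x : x \in `]a, b[ -> x \in `[a, b].
  by rewrite !in_itv /= => /andP[/ltW -> /ltW ->].
have [KP KP0 HP] := frob2_itv_bounded ab (fun x h => ex_intro _ _ (dP x h)).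
have [KA KA0 HA] := frob2_itv_bounded ab dA.
have [KB KB0 HB] := frob2_itv_bounded ab dB.
(* For |l| <= 1, [K1] is twice a bound for [frob2] of l A + l^2 B, the extra 2 coming from [frob2M];
   [K2] bounds the inhomogeneous term after division by l^2. The 1 in [K] and the factors 2 come
   from [is_derive_frob2] and [frob2D]. *)
pose K1 := 2 * (2 * (KA + KB)).
pose K2 := 2 * (2 * (KP * KA) + 2 * (KB + 2 * (KP * KB))).
pose K := 1 + 2 * K1 + 2 * K2.
have K10 : 0 <= K1 by rewrite /K1; nra.
have K20 : 0 <= K2 by rewrite /K2; nra.
(* The initial value of the Gronwall function is [frob2 (Y s) + e], at most (|C| + 1) e. *)
exists ((`|C| + 1) * expR (K * `|t - s|)) => l l1.
pose Y x := W x l - 1%:M - l *: P x.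
pose e := sqmod l ^+ 2.
have e0 : 0 <= e by rewrite sqr_ge0.
have sl0 : 0 <= sqmod l by exact: sqmod_ge0.
have sl2 : sqmod (l ^+ 2) = e by rewrite expr2 sqmodM.
have e1 : e <= 1 by rewrite /e exprn_ile1.
have dY x : x \in `[a, b] -> is_mxcderive x Y
   (Y x *m (l *: A x + l ^+ 2 *: B x) +
    l ^+ 2 *: (P x *m A x + (B x + l *: (P x *m B x)))).
  move=> xab.
  have h1 := is_mxcderiveD (dW x l xab) (is_mxcderive_cst x (- 1%:M)).
  have h2 := is_mxcderiveZ (- l) (dP x xab).
  have h := is_mxcderiveD h1 h2.
  have YE : Y = fun y => W y l + (- 1%:M) + (- l) *: P y.
    by apply/funext => y; rewrite /Y scaleNr.
  rewrite -YE in h; apply: is_mxcderive_eq h _.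
  rewrite /Y scaleNr 2!mulmxBl mul1mx -!scalemxAl.
  move: (W x l *m _) => WZ; rewrite mulmxDr -!scalemxAr.
  move: (P x *m A x) (P x *m B x) => PA PB.
  by apply/matrixP => i j; rewrite !mxE; ring.
have HN x : x \in `]a, b[ -> exists2 d,
    is_derive x 1 (fun y => frob2 (Y y) + e) d & `|d| <= K * (frob2 (Y x) + e).
  move=> /oc xab; have [d dN dle] := is_derive_frob2 (dY x xab).
  exists d.
    by rewrite -[d]addr0; apply: (@is_deriveD _ _ _ (fun y => frob2 (Y y)) (fun=> e)).
  apply: le_trans dle _.
  have := frob2D (Y x *m (l *: A x + l ^+ 2 *: B x))
    (l ^+ 2 *: (P x *m A x + (B x + l *: (P x *m B x)))).
  rewrite frob2Z sl2.
  have hA := HA x xab; have hB := HB x xab; have hP := HP x xab.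
  have a0 := frob2_ge0 (A x); have b0 := frob2_ge0 (B x).
  have p0 := frob2_ge0 (P x); have y0 := frob2_ge0 (Y x).
  have q1 : frob2 (l *: A x + l ^+ 2 *: B x) <= K1 / 2.
    rewrite [K1 / 2](_ : _ = 2 * (KA + KB)); last by rewrite /K1; lra.
    apply: le_trans (frob2D _ _) _; rewrite !frob2Z sl2.
    by rewrite ler_pM2l // lerD //; apply: le_trans (ler_piMl _ _) _.
  have q2 : frob2 (P x *m A x + (B x + l *: (P x *m B x))) <= K2.
    apply: le_trans (frob2D _ _) _; rewrite /K2 ler_pM2l // lerD //.
      by apply: le_trans (frob2M _ _) _; rewrite ler_pM2l // ler_pM.
    apply: le_trans (frob2D _ _) _; rewrite ler_pM2l // lerD // frob2Z.
    apply: le_trans (ler_piMl (frob2_ge0 _) l1) _.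
    by apply: le_trans (frob2M _ _) _; rewrite ler_pM2l // ler_pM.
  have q3 : frob2 (Y x *m (l *: A x + l ^+ 2 *: B x)) <= K1 * frob2 (Y x).
    apply: le_trans (frob2M _ _) _.
    have := ler_wpM2l y0 q1; lra.
  have q4 := ler_wpM2l e0 q2.
  move=> q5; rewrite /K; nra.
have := gronwall HN sab tab.
have -> : W t l - 1%:M - l *: P t = Y t by [].
move=> h; apply: le_trans (le_trans _ h) _; first by rewrite lerDl.
rewrite -mulrA (mulrC (expR _)) mulrA ler_pM2r ?expR_gt0 //.
have := HC l l1; rewrite -/(Y s) -/e mulrDl mul1r => ?.
by rewrite lerD2r; apply: le_trans (ler_wpM2r e0 (ler_norm C)).
Qed.

(** At l = 0 the bound vanishes and forces W(0) = 1; then the remainder of f is that of W multiplied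
    by F on the right. *)
Lemma quad_at_derive1 (W f : R[i] -> 'M[R[i]]_2) (P F : 'M[R[i]]_2) :
  quad_at W P -> f = (fun l => W l *m F) ->
  [/\ W 0 = 1%:M, derivable (f : R[i]^o -> 'M[R[i]]_2) 0 1 &
      derive1 f 0 = P *m F].
Proof.
move=> [C HC] ->.
have W0 : W 0 = 1%:M.
  have /HC : sqmod (0 : R[i]) <= 1 by rewrite /sqmod /= expr0n /= addr0 ler01.
  rewrite scale0r subr0 [sqmod 0](_ : _ = 0) ?expr0n /= ?mulr0; last first.
    by rewrite /sqmod /= expr0n /= addr0.
  move=> W0; apply/eqP; rewrite -subr_eq0; apply/eqP/matrixP => i j.
  have := le_trans (frob2_ge _ i j) W0; rewrite [in RHS]mxE.
  by rewrite -lecR sqmod_normE real_exprn_even_le0 //= normr_eq0 => /eqP.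
suff : derivable ((fun l => W l *m F) : R[i]^o -> 'M[R[i]]_2) 0 1 /\
   derive1 (fun l => W l *m F) 0 = P *m F by case.
apply: (@derive1_mx_quad _ _ _ (2 * (C * frob2 F))) => h h1.
rewrite -mulmxBl scalemxAl -mulmxBl W0.
apply: le_trans (frob2M _ _) _; rewrite -mulrA ler_pM2l // mulrAC.
by apply: ler_wpM2r; [exact: frob2_ge0|exact: HC].
Qed.

Lemma is_mxcderive_su2 x p (d : 'cV[R]_3) :
  (forall k, is_derive x 1 (fun s => p s k 0) (d k 0)) ->
  is_mxcderive x (fun s => su2_of_vec (p s)) (su2_of_vec d).
Proof.
move=> dp i j; rewrite su2_of_vecE mxE.
have dN k : is_derive x 1 (fun s => - p s k 0) (- d k 0).
  by apply: is_deriveN; exact: dp.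
have d0 : is_derive x 1 (fun=> 0 : R) 0 by exact: is_derive_cst.
rewrite (_ : (fun _ => _) = fun s => (mx_of_rows 2 2
  [:: [:: 0 +i* p s 0 0; p s 1 0 +i* p s 2 0];
      [:: - p s 1 0 +i* p s 2 0; 0 -i* p s 0 0]]) i j); last first.
  by apply/funext => s; rewrite su2_of_vecE.
case: i j => -[|[|//]] lti [] [|[|//]] ltj; split=> /=.
all: under eq_fun do rewrite mxE /=.
all: try solve [exact: dp|exact: dN|exact: d0].
Qed.
End SpectralExpansion.

(** * The Lax pair in su(2) *)

Section FrameAlgebra.
Context {R : realType}.
Local Open Scope sesquilinear_scope.

(** The first-order coefficient is built by integrating its velocity v from p0, and the expansion is
    carried along it by [quad_at_transport]. *)
Lemma quad_at_flow (W : R -> R[i] -> 'M[R[i]]_2) (v : R -> 'cV[R]_3)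
    (B : R -> 'M[R[i]]_2) (a b s : R) (p0 : 'cV[R]_3) :
  s \in `]a, b[ ->
  (forall x l, is_mxcderive x (fun y => W y l)
     (W x l *m (l *: su2_of_vec (v x) + l ^+ 2 *: B x))) ->
  (forall x k, derivable (fun y => v y k 0) x 1) ->
  (forall x, exists D, is_mxcderive x B D) ->
  quad_at (W s) (su2_of_vec p0) ->
  exists p : R -> 'cV[R]_3, p s = p0 /\ forall x, x \in `]a, b[ ->
    (forall k, is_derive x 1 (fun y => p y k 0) (v x k 0)) /\
    quad_at (W x) (su2_of_vec (p x)).
Proof.
move=> sab dW dv dB qs.
have cv k : continuous (fun y => v y k 0).
  by move=> x; exact/differentiable_continuous/derivable1_diffP/dv.
(* The antiderivative is taken on a larger open interval, so that its derivative is available on the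
   closed interval where transport asks for it. *)
have sab1 : s \in `]a - 1, b + 1[.
  by move: sab; rewrite !in_itv /= => /andP[h1 h2]; apply/andP; split; lra.
have /choice[P HP] k := antiderivative (p0 k 0) (cv k) sab1.
pose p x : 'cV[R]_3 := \col_k P k x.
have ps : p s = p0.
  by apply/colP => k; rewrite mxE; have [-> _] := HP k.
have pE k : (fun y => p y k 0) = P k by apply/funext => y; rewrite mxE.
exists p; split; [exact: ps | move=> x xab].
have dP y k : y \in `[a, b] -> is_derive y 1 (fun y => p y k 0) (v y k 0).
  rewrite in_itv /= => /andP[h1 h2]; rewrite pE; have [_] := HP k; apply.
  by rewrite in_itv /=; apply/andP; split; lra.
split; first by move=> k; apply: dP; exact: subset_itv_oo_cc.
apply: (@quad_at_transport _ W (fun y => su2_of_vec (p y))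
  (fun y => su2_of_vec (v y)) B a b s x sab xab).
- by move=> y l _; exact: dW.
- by move=> y yab; apply: is_mxcderive_su2 => k; exact: dP.
- move=> y _; exists (su2_of_vec (\col_k 'D_1 (fun z => v z k 0) y)).
  by apply: is_mxcderive_su2 => k; rewrite mxE; exact: derivableP.
- by move=> y _; exact: dB.
- by rewrite ps.
Qed.

Lemma adjmxM (m n p : nat) (M : 'M[R[i]]_(m, n)) (N : 'M[R[i]]_(n, p)) :
  (M *m N)^t* = N^t* *m M^t*.
Proof. by rewrite trmx_mul map_mxM. Qed.

Lemma adjmxK (m n : nat) (M : 'M[R[i]]_(m, n)) : M^t*^t* = M.
Proof. by apply/matrixP => i j; rewrite !mxE conjCK. Qed.

Lemma su2_conj (F X : 'M[R[i]]_2) :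
  F^t* *m F = 1%:M -> su2 X -> su2 (F *m X *m F^t*).
Proof.
move=> FF [X1 X2]; split.
  by rewrite !adjmxM adjmxK X1 mulNmx mulmxN mulmxA.
by rewrite mxtrace_mulC mulmxA FF mul1mx.
Qed.

Lemma su2_su2_a : su2 (su2_a R).
Proof.
have -> : su2_a R = su2_of_vec (\col_k (k == 0)%:R).
  by rewrite /su2_of_vec !mxE /= scale1r !scale0r !addr0.
exact: su2_of_vecP.
Qed.

Lemma lax_uE (q : R -> R -> R[i]) x t : lax_u q x t =
  (complex.Re (q x t))%:C *: su2_b R + (complex.Im (q x t))%:C *: su2_c R.
Proof.
apply/matrixP => i j; rewrite /lax_u /su2_b /su2_c !mxE; case: (q x t) => u v /=.
case: i j => -[|[|//]] lti [] [|[|//]] ltj /=; apply/eqP;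
  rewrite eq_complex /=; apply/andP; split; apply/eqP; ring.
Qed.

Lemma lax_u_su2 (q : R -> R -> R[i]) x t : lax_u q x t =
  su2_of_vec (\col_k [:: 0; complex.Re (q x t); complex.Im (q x t)]`_k).
Proof. by rewrite lax_uE /su2_of_vec !mxE /= scale0r add0r. Qed.

Lemma su2_lax_u (q : R -> R -> R[i]) x t : su2 (lax_u q x t).
Proof. by rewrite lax_u_su2; exact: su2_of_vecP. Qed.

Lemma adj_lax_Q (q : R -> R -> R[i]) x t : (lax_Q q x t)^t* = - lax_Q q x t.
Proof.
rewrite /lax_Q -sqmod_normE; apply/matrixP => i j; rewrite !mxE.
case: (cdx q x t) => u v /=; have e2 : (2^-1 : R[i]) = (2^-1)%:C.
  by rewrite fmorphV rmorphMn.
rewrite e2; case: i j => -[|[|//]] lti [] [|[|//]] ltj /=; apply/eqP;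
  rewrite eq_complex /=; apply/andP; split; apply/eqP; ring.
Qed.

(** Since U is anti-Hermitian, F' = F U makes the adjoint of F evolve by -U on the left; the product
    rule then leaves a commutator in the middle. *)
Lemma is_mxcderive_conj_flow (x : R) (F X : R -> 'M[R[i]]_2) (U D : 'M[R[i]]_2) :
  is_mxcderive x F (F x *m U) -> U^t* = - U -> is_mxcderive x X D ->
  is_mxcderive x (fun s => F s *m X s *m (F s)^t*)
    (F x *m (U *m X x - X x *m U + D) *m (F x)^t*).
Proof.
move=> dF UE dX.
have := is_mxcderiveM (is_mxcderiveM dF dX) (is_mxcderive_adj dF).
move=> /is_mxcderive_eq; apply; rewrite adjmxM UE.
rewrite !mulmxDr !mulmxDl !mulmxN !mulNmx !mulmxN !mulmxA.
by rewrite addrAC.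
Qed.

Lemma is_derive_vec_of_su2 (x : R) (M : R -> 'M[R[i]]_2) D k :
  is_mxcderive x M D ->
  is_derive x 1 (fun s => vec_of_su2 (M s) k 0) (vec_of_su2 D k 0).
Proof.
move=> dM; rewrite mxE; under eq_fun do rewrite mxE.
have [h1 _] := dM 0 1; have [_ h2] := dM 0 1; have [_ h3] := dM 0 0.
by case: k => -[|[|[|//]]] ltk /=.
Qed.

Lemma is_derive_colP (x : R) (m : nat) (p : R -> 'cV[R]_m) (d : 'cV[R]_m) :
  (forall k, is_derive x 1 (fun s => p s k 0) (d k 0)) -> is_derive x 1 p d.
Proof.
move=> dp; have pd : derivable p x 1.
  apply/derivable_mxP => i j; rewrite ord1.
  by have [] := dp i.
apply: DeriveDef => //; rewrite derive_mx //; apply/colP => k; rewrite mxE.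
by have [] := dp k.
Qed.

(** The matrix [a] squares to -1 and anticommutes with the off-diagonal [u]. Hence [u, a] = 2 u a,
    and bracketing with [a] once more doubles again. *)
Lemma lax_bracket (q : R -> R -> R[i]) x t (u := lax_u q x t) (a := su2_a R) :
  a *m (u *m a - a *m u) - (u *m a - a *m u) *m a = 4 *: u.
Proof.
have aa : a *m a = - 1%:M.
  apply/matrixP => i j; rewrite /a /su2_a !mxE !big_ord_recl big_ord0 !mxE /=.
  by case: i j => -[|[|//]] lti [] [|[|//]] ltj /=; apply/eqP;
    rewrite eq_complex /=; apply/andP; split; apply/eqP; ring.
have au : a *m u = - (u *m a).
  apply/matrixP => i j; rewrite /a /u /su2_a /lax_u !mxE !big_ord_recl !big_ord0 !mxE /=.
  by case: i j => -[|[|//]] lti [] [|[|//]] ltj /=; ring.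
have h1 : u *m a *m a = - u by rewrite -mulmxA aa mulmxN mulmx1.
have h2 : a *m (u *m a) = u by rewrite mulmxA au mulNmx h1 opprK.
by rewrite au opprK mulmxDr mulmxDl h1 h2 opprD opprK scaler_nat -addrA.
Qed.

Definition p_matrix (r1 r2 : R) : 'M[R]_3 :=
  mx_of_rows 3 3 [:: [:: 0; - r1; - r2]; [:: r1; 0; 0]; [:: r2; 0; 0]].

Lemma p_matrix_skew (r1 r2 : R) : (p_matrix r1 r2)^T = - p_matrix r1 r2.
Proof.
apply/matrixP => i j; rewrite !mxE.
by case: i j => -[|[|[|//]]] lti [] [|[|[|//]]] ltj /=; rewrite ?oppr0 ?opprK.
Qed.

(** In the basis (a, -c, b) the commutator with [u] acts by the p-frame matrix: for instance [b, a]
    = -2c and [c, a] = 2b give [u, a] = -r1 c + r2 b. The factor 2 of these brackets cancels the 1/2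
    in q. *)
Lemma lax_bracket_delta (q : R -> R -> R[i]) x t (r1 r2 : R) (j : 'I_3)
    (u := lax_u q x t) (d := delta R) : q x t = 1 / 2 * (r1 +i* r2) ->
  u *m d`_j - d`_j *m u = \sum_i (p_matrix r1 r2 i j)%:C *: d`_i.
Proof.
have e2 : (2^-1 : R[i]) = (2^-1)%:C by rewrite fmorphV rmorphMn.
move=> qE; rewrite /u /lax_u qE div1r e2 /d !big_ord_recl big_ord0 !mxE /=.
case: j => -[|[|[|//]]] ltj /=; rewrite /su2_a /su2_b /su2_c;
  apply/matrixP => i k; rewrite !mxE !big_ord_recl !big_ord0 !mxE /=.
all: case: i k => -[|[|//]] lti [] [|[|//]] ltk /=; apply/eqP;
  rewrite eq_complex /=; apply/andP; split; apply/eqP; lra.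
Qed.

Lemma vec_of_su2_sum (I : Type) (r : seq I) (c : I -> R) (X : I -> 'M[R[i]]_2) k :
  vec_of_su2 (\sum_(i <- r) (c i)%:C *: X i) k 0 =
  \sum_(i <- r) c i * vec_of_su2 (X i) k 0.
Proof.
elim: r => [|i r IH].
  by rewrite !big_nil !mxE; case: k => -[|[|[|//]]] ltk.
rewrite !big_cons -IH !mxE; case: k {IH} => -[|[|[|//]]] ltk /=;
  by rewrite ?ReD ?ImD ?ReM ?ImM /= mul0r ?subr0 ?addr0.
Qed.

Lemma unitary_mulC (F : 'M[R[i]]_2) :
  F^t* *m F = 1%:M -> F *m F^t* = 1%:M /\ invmx F = F^t*.
Proof.
move=> FF; have FF' := mulmx1C FF; split=> //.
have [Fu _] := mulmx1_unit FF'.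
by rewrite -[LHS]mulmx1 -FF' mulmxA mulVmx // mul1mx.
Qed.

Lemma frob2_trace (m n : nat) (M : 'M[R[i]]_(m, n)) :
  (frob2 M)%:C = \tr (M^t* *m M).
Proof.
rewrite /mxtrace (eq_bigr (fun j => \sum_i (sqmod (M i j))%:C)); last first.
  move=> j _; rewrite !mxE; apply: eq_bigr => i _.
  by rewrite !mxE mulrC sqmod_normE normCK.
by rewrite exchange_big /frob2 rmorph_sum; apply: eq_bigr => i _; rewrite rmorph_sum.
Qed.

(** The squared norm is the trace of the identity. This uniform bound on the frame is what controls
    its partial derivatives. *)
Lemma frob2_unitary (F : 'M[R[i]]_2) : F^t* *m F = 1%:M -> frob2 F = 2.
Proof.
move=> FF; apply: complexI; rewrite frob2_trace FF mxtrace1.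
by rewrite [in RHS]rmorphMn.
Qed.

(** With G = [Ad_delta] of F, both G and g satisfy the same linear equation with a skew matrix, so
    the product of G and the transpose of g has zero derivative. It equals 1 at the origin, hence
    everywhere, and orthogonality of g gives G = g. *)
Lemma Ad_delta_p_frame (F : R -> 'M[R[i]]_2) (q : R -> R -> R[i])
    (g : R -> 'M[R]_3) (r1 r2 : R -> R) :
  (forall x, (F x)^t* *m F x = 1%:M) ->
  (forall x, is_mxcderive x F (F x *m lax_u q x 0)) ->
  (forall x, q x 0 = 1 / 2 * (r1 x +i* r2 x)) ->
  (forall x, derivable g x 1) -> (forall x, (g x)^T *m g x = 1%:M) ->
  (forall x, invmx (g x) *m derive1 g x = p_matrix (r1 x) (r2 x)) ->
  g 0 = Ad_delta (F 0) -> forall x, g x = Ad_delta (F x).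
Proof.
move=> FF dF qE dg gg gM g0 x.
pose G y := Ad_delta (F y).
have dG (y : R) k j : is_derive y 1 (fun z => G z k j)
    ((G y *m p_matrix (r1 y) (r2 y)) k j).
  have GE z i : G z k i = vec_of_su2 (F z *m (delta R)`_i *m (F z)^t*) k 0.
    by have [_ <-] := unitary_mulC (FF z); rewrite mxE.
  rewrite (_ : (fun z => _) = (fun z =>
    vec_of_su2 (F z *m (delta R)`_j *m (F z)^t*) k 0)); last exact/funext.
  have [uE _] := su2_lax_u q y 0.
  have := is_mxcderive_conj_flow (dF y) uE (is_mxcderive_cst y (delta R)`_j).
  rewrite addr0 (lax_bracket_delta j (qE y)) mulmx_sumr mulmx_suml.
  under eq_bigr do rewrite -scalemxAr -scalemxAl.
  move=> /(is_derive_vec_of_su2 k) /is_derive_eq; apply.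
  rewrite vec_of_su2_sum mxE; apply: eq_bigr => i _.
  by rewrite GE mulrC.
have dgE (y : R) k j : is_derive y 1 (fun z => g z k j)
    ((g y *m p_matrix (r1 y) (r2 y)) k j).
  have [_ gu] := mulmx1_unit (gg y).
  rewrite -gM mulKVmx // derive1E derive_mx // mxE; apply: derivableP.
  by have /derivable_mxP := dg y; apply.
have cD k l : (G x *m (g x)^T) k l = (G 0 *m (g 0)^T) k l.
  apply: (@is_derive_0_is_cst R (fun y => (G y *m (g y)^T) k l) x 0) => y.
  have := is_derive_sum (fun j => is_deriveM (dG y k j) (dgE y l j)).
  rewrite (_ : (\sum_(i < 3) _) = (fun y => (G y *m (g y)^T) k l)); last first.
    apply/funext => z; rewrite fct_sumE mxE; apply: eq_bigr => j _.
    by rewrite [(g z)^T j l]mxE.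
  move=> /is_derive_eq; apply.
  rewrite (_ : \sum_(i < 3) _ = (G y *m (g y *m p_matrix (r1 y) (r2 y))^T +
     G y *m p_matrix (r1 y) (r2 y) *m (g y)^T) k l); last first.
    rewrite !mxE -big_split; apply: eq_bigr => j _ /=.
    by rewrite !mxE /GRing.scale /= [in X in _ + X]mulrC.
  by rewrite trmx_mul p_matrix_skew mulNmx mulmxN mulmxA addNr mxE.
have {}cD : G x *m (g x)^T = 1%:M.
  apply/matrixP => k l; rewrite cD /G -g0.
  by have -> := mulmx1C (gg 0).
by rewrite -[LHS]mul1mx -cD -mulmxA gg mulmx1.
Qed.

End FrameAlgebra.

(** * Joint smoothness from separate derivatives *)

Section JointSmoothness.
Context {R : realType}.
Implicit Types (f g : R -> R -> R).

(** The increment is split into a vertical step on the line x = x0 and a horizontal step at height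
    t, each estimated by the mean value theorem. *)
Lemma continuous_of_partials (f fx ft : R -> R -> R) (K : R) (z : R * R) :
  (forall x t : R, is_derive x 1 (f^~ t) (fx x t)) ->
  (forall x t : R, is_derive t 1 (f x) (ft x t)) ->
  (\forall w \near z, `|fx w.1 w.2| <= K /\ `|ft w.1 w.2| <= K) ->
  {for z, continuous (fun w : R * R => f w.1 w.2)}.
Proof.
case: z => x0 t0 dfx dft.
case=> -[A B] /= [/nbhs_ballP[r1 /= r10 rA] /nbhs_ballP[r2 /= r20 rB]] AB.
have lip (h dh : R -> R) (a b r c : R) :
    (forall y : R, is_derive y 1 h (dh y)) -> ball c r a -> ball c r b ->
    (forall y, ball c r y -> `|dh y| <= K) -> `|h a - h b| <= K * `|a - b|.
  move=> dh_ + + H.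
  wlog ab : a b / b <= a.
    move=> W ca cb; have [/W|/ltW/W] := leP b a; first exact.
    by rewrite distrC (distrC b); apply.
  rewrite /ball /= !ltr_distlC => /andP[a1 a2] /andP[b1 b2].
  have [|y yab ->] := @MVT_segment R h dh b a ab (fun y _ => dh_ y).
    apply: continuous_subspaceT => y.
    by apply/differentiable_continuous/derivable1_diffP; have [] := dh_ y.
  rewrite normrM ler_wpM2r //; apply: H; rewrite /ball /= ltr_distlC.
  by move: yab; rewrite in_itv /= => /andP[h1 h2]; apply/andP; split; lra.
apply/cvgrPdist_le => e e0.
have K0 : 0 <= K.
  have [|+ _] := AB (x0, t0); first by split; [apply: rA|apply: rB]; exact: ballxx.
  exact: le_trans.
(* Each of the two steps may cost half of e; K + 1 stays positive when K = 0. *)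
pose d := e / (2 * (K + 1)).
have d0 : 0 < d by rewrite divr_gt0 // mulr_gt0 // ltr_wpDl.
exists (ball x0 (Num.min r1 d), ball t0 (Num.min r2 d)).
  by split; apply: nbhsx_ballx; rewrite lt_min ?r10 ?r20.
move=> [x t] [/= bx bt].
have {bx} [bx dx0] : ball x0 r1 x /\ `|x0 - x| < d.
  by move: bx; rewrite /ball /= lt_min => /andP[].
have {bt} [bt dt0] : ball t0 r2 t /\ `|t0 - t| < d.
  by move: bt; rewrite /ball /= lt_min => /andP[].
have h1 : `|f x0 t - f x t| <= K * `|x0 - x|.
  apply: (lip (f^~ t) (fx^~ t) x0 x r1 x0) => //; first exact: ballxx.
  by move=> y yb; have [] := AB (y, t) (conj (rA _ yb) (rB _ bt)).
have h2 : `|f x0 t0 - f x0 t| <= K * `|t0 - t|.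
  apply: (lip (f x0) (ft x0) t0 t r2 t0) => //; first exact: ballxx.
  by move=> y yb; have [] := AB (x0, y) (conj (rA _ (ballxx _ r10)) (rB _ yb)).
rewrite -(subrKA (f x0 t)) (le_trans (ler_normD _ _)) //.
have dE : e = d * (2 * (K + 1)) by rewrite /d divfK // gt_eqF // mulr_gt0 // ltr_wpDl.
rewrite dE; nra.
Qed.

Lemma Ck2_continuous (V : normedModType R) n (f : R -> R -> V) :
  Ck2 n f -> continuous (fun z : R * R => f z.1 z.2).
Proof. by case: n => [|n] []. Qed.

Lemma Ck2_pred (V : normedModType R) n (f : R -> R -> V) : Ck2 n.+1 f -> Ck2 n f.
Proof.
elim: n f => [|n IH] f [cf [fx ft dfx dft]]; first by [].
by split => //; split => //; exact: IH.
Qed.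

(** Introduction rule with explicit formulas for the partial derivatives; joint continuity is a
    separate premise because separate differentiability does not give it. *)
Lemma Ck2_is_derive n (f fx ft : R -> R -> R) :
  (forall x t : R, is_derive x 1 (f^~ t) (fx x t)) ->
  (forall x t : R, is_derive t 1 (f x) (ft x t)) ->
  continuous (fun z : R * R => f z.1 z.2) ->
  Ck2 n fx -> Ck2 n ft -> Ck2 n.+1 f.
Proof.
move=> dfx dft cf nx nt; split=> //; split.
- by move=> x t; have [] := dfx x t.
- by move=> x t; have [] := dft x t.
- rewrite (_ : dx f = fx) //; apply/funext => x; apply/funext => t.
  by rewrite /dx derive1E; have [] := dfx x t.
- rewrite (_ : dt f = ft) //; apply/funext => x; apply/funext => t.
  by rewrite /dt derive1E; have [] := dft x t.
Qed.

Lemma Ck2_derivex n f (x t : R) : Ck2 n.+1 f -> is_derive x 1 (f^~ t) (dx f x t).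
Proof. by move=> [_ [+ _ _ _]] => h; rewrite /dx derive1E; exact: derivableP. Qed.

Lemma Ck2_derivet n f (x t : R) : Ck2 n.+1 f -> is_derive t 1 (f x) (dt f x t).
Proof. by move=> [_ [_ + _ _]] => h; rewrite /dt derive1E; exact: derivableP. Qed.

Lemma Ck2_cst n (c : R) : Ck2 n (fun _ _ : R => c).
Proof.
elim: n c => [|n IH] c; first by split => // ?; exact: cvg_cst.
apply: (@Ck2_is_derive _ _ (fun _ _ => 0) (fun _ _ => 0)).
- by move=> x t; exact: (@is_derive_cst _ _ _ c).
- by move=> z; exact: cvg_cst.
- exact: IH.
- exact: IH.
Qed.

Lemma Ck2D n f g : Ck2 n f -> Ck2 n g -> Ck2 n (fun x t => f x t + g x t).
Proof.
have cD f' g' m : Ck2 m f' -> Ck2 m g' ->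
    continuous (fun z : R * R => f' z.1 z.2 + g' z.1 z.2).
  move=> /Ck2_continuous cf /Ck2_continuous cg z.
  by apply: cvgD; [exact: cf|exact: cg].
elim: n f g => [|n IH] f g hf hg; first by split=> //; exact: cD hf hg.
apply: (@Ck2_is_derive _ _ (fun x t => dx f x t + dx g x t)
  (fun x t => dt f x t + dt g x t)).
- by move=> x t; exact: (is_deriveD (Ck2_derivex x t hf) (Ck2_derivex x t hg)).
- by move=> x t; exact: (is_deriveD (Ck2_derivet x t hf) (Ck2_derivet x t hg)).
- exact: cD hf hg.
- by case: hf hg => _ [_ _ ? _] [_ [_ _ ? _]]; exact: IH.
- by case: hf hg => _ [_ _ _ ?] [_ [_ _ _ ?]]; exact: IH.
Qed.

Lemma Ck2M n f g : Ck2 n f -> Ck2 n g -> Ck2 n (fun x t => f x t * g x t).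
Proof.
have cM f' g' m : Ck2 m f' -> Ck2 m g' ->
    continuous (fun z : R * R => f' z.1 z.2 * g' z.1 z.2).
  move=> /Ck2_continuous cf /Ck2_continuous cg z.
  by apply: cvgM; [exact: cf|exact: cg].
elim: n f g => [|n IH] f g hf hg; first by split=> //; exact: cM hf hg.
apply: (@Ck2_is_derive _ _ (fun x t => f x t * dx g x t + g x t * dx f x t)
  (fun x t => f x t * dt g x t + g x t * dt f x t)).
- move=> x t; exact: (is_deriveM (Ck2_derivex x t hf) (Ck2_derivex x t hg)).
- move=> x t; exact: (is_deriveM (Ck2_derivet x t hf) (Ck2_derivet x t hg)).
- exact: cM hf hg.
(* The Leibniz rule also contains the undifferentiated factors, which are needed at the lower
   order. *)
- have f1 := Ck2_pred hf; have g1 := Ck2_pred hg.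
  by case: hf hg => _ [_ _ ? _] [_ [_ _ ? _]]; apply: Ck2D; exact: IH.
- have f1 := Ck2_pred hf; have g1 := Ck2_pred hg.
  by case: hf hg => _ [_ _ _ ?] [_ [_ _ _ ?]]; apply: Ck2D; exact: IH.
Qed.

Lemma Ck2N n f : Ck2 n f -> Ck2 n (fun x t => - f x t).
Proof.
move=> /(Ck2M (Ck2_cst n (-1))); congr Ck2.
by apply/funext => x; apply/funext => t; rewrite mulN1r.
Qed.

Definition mxCk2 m p n (M : R -> R -> 'M[R[i]]_(m, p)) := forall i j,
  Ck2 n (fun x t => complex.Re (M x t i j)) /\
  Ck2 n (fun x t => complex.Im (M x t i j)).

Lemma mxCk2M m p k n (M : R -> R -> 'M[R[i]]_(m, p))
    (N : R -> R -> 'M[R[i]]_(p, k)) :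
  mxCk2 n M -> mxCk2 n N -> mxCk2 n (fun x t => M x t *m N x t).
Proof.
move=> hM hN i j.
(* One additive map h stands for both the real and the imaginary part in the reduction to single
   products. *)
have sumE (h : {additive R[i] -> R}) :
    (forall l, Ck2 n (fun x t => h (M x t i l * N x t l j))) ->
    Ck2 n (fun x t => h ((M x t *m N x t) i j)).
  move=> H; rewrite (_ : (fun _ => _) = fun x t =>
    \sum_l h (M x t i l * N x t l j)); last first.
    by apply/funext => x; apply/funext => t; rewrite mxE raddf_sum.
  elim: (index_enum _) => [|l r IH].
    rewrite (_ : (fun _ => _) = fun _ _ => 0); first exact: Ck2_cst.
    by apply/funext => x; apply/funext => t; rewrite big_nil.
  rewrite (_ : (fun _ => _) = fun x t => h (M x t i l * N x t l j) +
    \sum_(l <- r) h (M x t i l * N x t l j)); first exact: Ck2D.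
  by apply/funext => x; apply/funext => t; rewrite big_cons.
split.
- apply: (sumE (@complex.Re R)) => l; have [a b] := hM i l; have [c d] := hN l j.
  rewrite [X in Ck2 _ X](_ : _ = fun x t =>
    complex.Re (M x t i l) * complex.Re (N x t l j) +
    - (complex.Im (M x t i l) * complex.Im (N x t l j))); last first.
    by apply/funext => x; apply/funext => t; exact: ReM.
  by apply: Ck2D; [exact: Ck2M|apply: Ck2N; exact: Ck2M].
- apply: (sumE (@complex.Im R)) => l; have [a b] := hM i l; have [c d] := hN l j.
  rewrite [X in Ck2 _ X](_ : _ = fun x t =>
    complex.Re (M x t i l) * complex.Im (N x t l j) +
    complex.Im (M x t i l) * complex.Re (N x t l j)); last first.
    by apply/funext => x; apply/funext => t; exact: ImM.
  by apply: Ck2D; exact: Ck2M.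
Qed.

Lemma mxCk2_cst m p n (M : 'M[R[i]]_(m, p)) : mxCk2 n (fun _ _ => M).
Proof. by move=> i j; split; exact: Ck2_cst. Qed.

Local Open Scope sesquilinear_scope.
Lemma mxCk2_adj m p n (M : R -> R -> 'M[R[i]]_(m, p)) :
  mxCk2 n M -> mxCk2 n (fun x t => (M x t)^t*).
Proof.
move=> hM i j; have [h1 h2] := hM j i; split.
- rewrite (_ : (fun _ => _) = fun x t => complex.Re (M x t j i)) //.
  by apply/funext => x; apply/funext => t; rewrite !mxE; case: (M x t j i).
- rewrite (_ : (fun _ => _) = fun x t => - complex.Im (M x t j i)).
    exact: Ck2N.
  by apply/funext => x; apply/funext => t; rewrite !mxE; case: (M x t j i).
Qed.
Local Close Scope sesquilinear_scope.

Lemma mx_continuous (T : topologicalType) (m p : nat) (M : T -> 'M[R]_(m, p)) :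
  (forall i j, continuous (fun z => M z i j)) -> continuous M.
Proof.
move=> cM z; apply/cvgrPdist_le => e e0.
near=> w; rewrite [X in X <= _](_ : _ = mx_norm (M z - M w)) // mx_normrE.
rewrite (bigmax_le _ (ltW e0)) // => i _; rewrite !mxE.
move: i; near: w; apply: filter_forall => -[i j] /=.
by have /cvgrPdist_le := cM i j z; apply.
Unshelve. all: by end_near. Qed.

Lemma Ck2_colP n m (p : R -> R -> 'cV[R]_m) :
  (forall k, Ck2 n (fun x t => p x t k 0)) -> Ck2 n p.
Proof.
elim: n p => [|n IH] p hp.
  by split => //; apply: mx_continuous => i j; rewrite ord1; have [] := hp i.
have dpx (x t : R) : is_derive x 1 (p^~ t) (\col_k dx (fun x t => p x t k 0) x t).
  by apply: is_derive_colP => k; rewrite mxE; exact: (Ck2_derivex x t (hp k)).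
have dpt (x t : R) : is_derive t 1 (p x) (\col_k dt (fun x t => p x t k 0) x t).
  by apply: is_derive_colP => k; rewrite mxE; exact: (Ck2_derivet x t (hp k)).
split; first by apply: mx_continuous => i j; rewrite ord1; have [] := hp i.
split.
- by move=> x t; have [] := dpx x t.
- by move=> x t; have [] := dpt x t.
- rewrite (_ : dx p = fun x t => \col_k dx (fun x t => p x t k 0) x t).
    apply: IH => k; under eq_fun do under eq_fun do rewrite mxE.
    by have [_ []] := hp k.
  apply/funext => x; apply/funext => t; rewrite {1}/dx derive1E.
  by have [] := dpx x t.
- rewrite (_ : dt p = fun x t => \col_k dt (fun x t => p x t k 0) x t).
    apply: IH => k; under eq_fun do under eq_fun do rewrite mxE.
    by have [_ []] := hp k.
  apply/funext => x; apply/funext => t; rewrite {1}/dt derive1E.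
  by have [] := dpt x t.
Qed.

End JointSmoothness.

(** * Frames of NLS solutions *)

Section NLSFrame.
Context {R : realType}.
Local Open Scope sesquilinear_scope.

Lemma csmooth2_lax_u (q : R -> R -> R[i]) n :
  csmooth2 q -> mxCk2 n (lax_u q).
Proof.
move=> [q1 q2] i j.
have h1 := q1 n; have h2 := q2 n; have h3 := Ck2_cst n (0 : R).
have h4 := Ck2N h1; split.
- rewrite (_ : (fun _ => _) = fun x t => nth 0 (nth [::]
    [:: [:: 0; complex.Re (q x t)]; [:: - complex.Re (q x t); 0]] i) j).
    by case: i j => -[|[|//]] lti [] [|[|//]] ltj.
  apply/funext => x; apply/funext => t; rewrite lax_u_su2 su2_of_vecE !mxE.
  by case: i j => -[|[|//]] lti [] [|[|//]] ltj.
- rewrite (_ : (fun _ => _) = fun x t => nth 0 (nth [::]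
    [:: [:: 0; complex.Im (q x t)]; [:: complex.Im (q x t); - 0]] i) j).
    case: i j => -[|[|//]] lti [] [|[|//]] ltj //=; exact: (Ck2N h3).
  apply/funext => x; apply/funext => t; rewrite lax_u_su2 su2_of_vecE !mxE.
  by case: i j => -[|[|//]] lti [] [|[|//]] ltj.
Qed.

(** The matrix contains q_x, so order n uses order n + 1 of q; |q|^2 enters through its polynomial
    form [sqmod]. *)
Lemma csmooth2_lax_Q (q : R -> R -> R[i]) n :
  csmooth2 q -> mxCk2 n (lax_Q q).
Proof.
move=> [q1 q2].
have h1 := q1 n; have h2 := q2 n; have h0 := Ck2_cst n (0 : R).
have d1 : Ck2 n (fun x t => complex.Re (cdx q x t)) by case: (q1 n.+1) => _ [].
have d2 : Ck2 n (fun x t => complex.Im (cdx q x t)) by case: (q2 n.+1) => _ [].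
have n2 : Ck2 n (fun x t => sqmod (q x t)).
  by rewrite /sqmod; under eq_fun do under eq_fun do rewrite !expr2;
    apply: Ck2D; exact: Ck2M.
have hM : mxCk2 n (fun x t => mx_of_rows 2 2
    [:: [:: - `|q x t| ^+ 2; cdx q x t]; [:: (cdx q x t)^*%C; `|q x t| ^+ 2]]).
  move=> i j; split.
  - rewrite (_ : (fun _ => _) = fun x t => nth 0 (nth [::]
      [:: [:: - sqmod (q x t); complex.Re (cdx q x t)];
          [:: complex.Re (cdx q x t); sqmod (q x t)]] i) j).
      case: i j => -[|[|//]] lti [] [|[|//]] ltj //=; exact: Ck2N.
    apply/funext => x; apply/funext => t; rewrite -sqmod_normE !mxE.
    by case: i j => -[|[|//]] lti [] [|[|//]] ltj //=; case: cdx.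
  - rewrite (_ : (fun _ => _) = fun x t => nth 0 (nth [::]
      [:: [:: - 0; complex.Im (cdx q x t)];
          [:: - complex.Im (cdx q x t); 0]] i) j).
      case: i j => -[|[|//]] lti [] [|[|//]] ltj //=; exact: Ck2N.
    apply/funext => x; apply/funext => t; rewrite -sqmod_normE !mxE.
    by case: i j => -[|[|//]] lti [] [|[|//]] ltj //=; case: cdx.
(* The factor i/2 is treated as a constant scalar matrix, so that the product rule covers it. *)
have := mxCk2M (mxCk2_cst n (('i%C / 2)%:M : 'M[R[i]]_2)) hM.
by under eq_fun do under eq_fun do rewrite mul_scalar_mx.
Qed.

Lemma Ck2_frob2 n (M : R -> R -> 'M[R[i]]_2) :
  mxCk2 n M -> Ck2 n (fun x t => frob2 (M x t)).
Proof.
move=> hM; have sq i j : Ck2 n (fun x t => sqmod (M x t i j)).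
  have [h1 h2] := hM i j; rewrite /sqmod.
  under eq_fun do under eq_fun do rewrite !expr2.
  exact: (Ck2D (Ck2M h1 h1) (Ck2M h2 h2)).
rewrite /frob2; under eq_fun do under eq_fun do
  rewrite !big_ord_recl !big_ord0 !addr0.
exact: (Ck2D (Ck2D (sq _ _) (sq _ _)) (Ck2D (sq _ _) (sq _ _))).
Qed.

Lemma continuous_near_le (f : R * R -> R) (z : R * R) :
  continuous f -> \forall w \near z, `|f w| <= `|f z| + 1.
Proof.
move=> cf; have /cvgrPdist_le/(_ 1 ltr01) := cf z; apply: filterS => w.
move=> h; rewrite -lerBlDl; apply: le_trans h.
by rewrite distrC (le_trans (ler_norm _)) // ler_dist_dist.
Qed.

(** * Regularity of the frame at spectral parameter zero *)

Context (q : R -> R -> R[i]) (E : R -> R -> R[i] -> 'M[R[i]]_2).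
Context (qs : csmooth2 q) (hE : NLS_frame q E).
Context (phi0 : 'M[R[i]]_2) (hphi0 : SU2 phi0) (hE0 : forall l, E 0 0 l = phi0).

Let F x t := E x t 0.
Let Fa x t := (F x t)^t*.

Lemma frame_unitary x t : Fa x t *m F x t = 1%:M.
Proof. by have [_ _ _ _ /(_ x t 0)] := hE; rewrite conjc0. Qed.

Lemma frame_derivex x t l :
  is_mxcderive x (fun s => E s t l) (E x t l *m (l *: su2_a R + lax_u q x t)).
Proof.
have [Eu dE Ex _ _] := hE; rewrite -Ex mulKVmx //.
by apply: is_mxcderiveP; case: (dE x t l).
Qed.

Lemma frame_derivet x t l : is_mxcderive t (fun s => E x s l)
  (E x t l *m (l ^+ 2 *: su2_a R + l *: lax_u q x t + lax_Q q x t)).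
Proof.
have [Eu dE _ Et _] := hE; rewrite -Et mulKVmx //.
by apply: is_mxcderiveP; case: (dE x t l).
Qed.

Lemma frame0_derivex x t : is_mxcderive x (F^~ t) (F x t *m lax_u q x t).
Proof. by have := frame_derivex x t 0; rewrite scale0r add0r. Qed.

Lemma frame0_derivet x t : is_mxcderive t (F x) (F x t *m lax_Q q x t).
Proof. by have := frame_derivet x t 0; rewrite expr2 mul0r !scale0r !add0r. Qed.

(** As F has squared norm 2, [frob2M] gives at most 4 [frob2 U] for the product; then |c| <= 1 + c^2
    passes from the square to the absolute value. *)
Lemma frame0_mul_le (U : 'M[R[i]]_2) x t i j :
  `|complex.Re ((F x t *m U) i j)| <= 1 + 4 * frob2 U /\
  `|complex.Im ((F x t *m U) i j)| <= 1 + 4 * frob2 U.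
Proof.
have := frob2_ge (F x t *m U) i j.
have := frob2M (F x t) U; rewrite (frob2_unitary (frame_unitary x t)).
set c := complex.Re _; set d := complex.Im _; rewrite /sqmod -/c -/d => h1 h2.
have c2 : `|c| ^+ 2 = c ^+ 2 by rewrite real_normK ?num_real.
have d2 : `|d| ^+ 2 = d ^+ 2 by rewrite real_normK ?num_real.
have := sqr_ge0 (`|c| - 1); have := sqr_ge0 (`|d| - 1).
have := sqr_ge0 c; have := sqr_ge0 d; have := frob2_ge0 U.
by split; nra.
Qed.

(** Here h is the real or the imaginary part. The partial derivatives are entries of F u and F Q,
    locally bounded because F is unitary and u, Q are continuous. *)
Lemma frame0_continuous (h : R[i] -> R) i j :
  (forall (x : R) f c, is_cderive x f c -> is_derive x 1 (h \o f) (h c)) ->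
  (forall U x t, `|h ((F x t *m U) i j)| <= 1 + 4 * frob2 U) ->
  continuous (fun z : R * R => h (F z.1 z.2 i j)).
Proof.
move=> dh hle z.
have cu := Ck2_continuous (Ck2_frob2 (csmooth2_lax_u 0 qs)).
have cQ := Ck2_continuous (Ck2_frob2 (csmooth2_lax_Q 0 qs)).
apply: (@continuous_of_partials R (fun x t => h (F x t i j))
  (fun x t => h ((F x t *m lax_u q x t) i j))
  (fun x t => h ((F x t *m lax_Q q x t) i j))
  (1 + 4 * ((`|frob2 (lax_u q z.1 z.2)| + 1) +
            (`|frob2 (lax_Q q z.1 z.2)| + 1)))).
- by move=> x t; apply: dh (frame0_derivex x t i j).
- by move=> x t; apply: dh (frame0_derivet x t i j).
- have := continuous_near_le z cQ; have := continuous_near_le z cu.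
  apply: filterS2 => w h1 h2.
  have := hle (lax_u q w.1 w.2) w.1 w.2; have := hle (lax_Q q w.1 w.2) w.1 w.2.
  have u0 := frob2_ge0 (lax_u q w.1 w.2); have Q0 := frob2_ge0 (lax_Q q w.1 w.2).
  rewrite (ger0_norm u0) in h1; rewrite (ger0_norm Q0) in h2.
  by move=> b1 b2; split; [apply: le_trans b2 _|apply: le_trans b1 _]; lra.
Qed.

Lemma frame0_smooth n : mxCk2 n F.
Proof.
have cRe i j : continuous (fun z : R * R => complex.Re (F z.1 z.2 i j)).
  apply: frame0_continuous; first by move=> x f c [].
  by move=> U x t; have [] := frame0_mul_le U x t i j.
have cIm i j : continuous (fun z : R * R => complex.Im (F z.1 z.2 i j)).
  apply: frame0_continuous; first by move=> x f c [].
  by move=> U x t; have [] := frame0_mul_le U x t i j.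
(* Continuity is the base case; F of order n makes F u and F Q of order n, so F gains one order. *)
elim: n => [|n IH] i j; first by split; split.
have [hu1 hu2] := mxCk2M IH (csmooth2_lax_u n qs) i j.
have [hQ1 hQ2] := mxCk2M IH (csmooth2_lax_Q n qs) i j.
split.
- apply: (Ck2_is_derive _ _ (cRe i j) hu1 hQ1) => x t.
    by have [] := frame0_derivex x t i j.
  by have [] := frame0_derivet x t i j.
- apply: (Ck2_is_derive _ _ (cIm i j) hu2 hQ2) => x t.
    by have [] := frame0_derivex x t i j.
  by have [] := frame0_derivet x t i j.
Qed.

(** * Evolution of the spectral ratio *)

Definition frame_conj (X : 'M[R[i]]_2) x t := F x t *m X *m Fa x t.

(** These will be the x- and t-derivatives of [alpha], and [W] is the ratio of the frame at l to the
    frame at 0. The inverse of F is written throughout as its adjoint, which is differentiated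
    entrywise. *)
Let tangent := frame_conj (su2_a R).
Let normal x t := frame_conj (lax_u q x t) x t.
Let W x t l := E x t l *m Fa x t.

Lemma su2_tangent x t : su2 (tangent x t).
Proof. by apply: su2_conj; [exact: frame_unitary|exact: su2_su2_a]. Qed.

Lemma su2_normal x t : su2 (normal x t).
Proof. by apply: su2_conj; [exact: frame_unitary|exact: su2_lax_u]. Qed.

Lemma spectral_ratio_frame_conj x t l (X : 'M[R[i]]_2) :
  W x t l *m frame_conj X x t = E x t l *m X *m Fa x t.
Proof.
by rewrite /W /frame_conj !mulmxA -(mulmxA _ (Fa x t) (F x t)) frame_unitary mulmx1.
Qed.

(** The two [u] terms, from E and from the adjoint of F, cancel. The zero l^2 term puts the equation
    in the form that [quad_at_flow] expects. *)
Lemma spectral_ratio_derivex x t l : is_mxcderive x (fun s => W s t l)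
  (W x t l *m (l *: tangent x t + l ^+ 2 *: 0)).
Proof.
have [uE _] := su2_lax_u q x t.
have := is_mxcderiveM (frame_derivex x t l) (is_mxcderive_adj (frame0_derivex x t)).
move=> /is_mxcderive_eq; apply.
rewrite scaler0 addr0 -scalemxAr /tangent spectral_ratio_frame_conj adjmxM uE.
rewrite mulmxDr mulmxDl -scalemxAr -scalemxAl mulNmx mulmxN mulmxA.
by rewrite addrK.
Qed.

(** The [Q] terms cancel in the same way, leaving [u] at order l and [a] at order l^2. *)
Lemma spectral_ratio_derivet x t l : is_mxcderive t (fun s => W x s l)
  (W x t l *m (l *: normal x t + l ^+ 2 *: tangent x t)).
Proof.
have dE := frame_derivet x t l; have dF := frame0_derivet x t.
have QE := adj_lax_Q q x t.
move: (lax_Q q x t) QE dE dF => Q QE dE dF.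
apply: is_mxcderive_eq (is_mxcderiveM dE (is_mxcderive_adj dF)) _.
rewrite [RHS]mulmxDr -!scalemxAr /normal /tangent !spectral_ratio_frame_conj adjmxM QE.
rewrite mulmxDr mulmxDl mulNmx mulmxN mulmxA addrK.
by rewrite mulmxDr mulmxDl -!scalemxAr -!scalemxAl addrC.
Qed.

Lemma lax_u_derivet x t : exists D, is_mxcderive t (lax_u q x) D.
Proof.
have h := csmooth2_lax_u 1 qs.
exists (\matrix_(i, j) (dt (fun x t => complex.Re (lax_u q x t i j)) x t +i*
  dt (fun x t => complex.Im (lax_u q x t i j)) x t)) => i j.
by have [h1 h2] := h i j; rewrite mxE; split; [exact: (Ck2_derivet x t h1)|
  exact: (Ck2_derivet x t h2)].
Qed.

Lemma tangent_derivex x t : is_mxcderive x (tangent^~ t)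
  (frame_conj (lax_u q x t *m su2_a R - su2_a R *m lax_u q x t) x t).
Proof.
have [uE _] := su2_lax_u q x t.
have := is_mxcderive_conj_flow (frame0_derivex x t) uE (is_mxcderive_cst x (su2_a R)).
by rewrite addr0.
Qed.

(** In the t direction [tangent] is the quadratic coefficient, for which transport asks only that a
    derivative exist. *)
Lemma tangent_derivet x t : exists D, is_mxcderive t (tangent x) D.
Proof.
by have := is_mxcderive_conj_flow (frame0_derivet x t) (adj_lax_Q q x t)
  (is_mxcderive_cst t (su2_a R)); eexists; eassumption.
Qed.

Lemma normal_derivet x t : exists D, is_mxcderive t (normal x) D.
Proof.
have [D dD] := lax_u_derivet x t.
by have := is_mxcderive_conj_flow (frame0_derivet x t) (adj_lax_Q q x t) dD;
  eexists; eassumption.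
Qed.

Lemma mxCk2_frame_conj n (X : R -> R -> 'M[R[i]]_2) :
  mxCk2 n X -> mxCk2 n (fun x t => frame_conj (X x t) x t).
Proof.
move=> hX; apply: mxCk2M; last exact: mxCk2_adj (frame0_smooth n).
exact: mxCk2M (frame0_smooth n) hX.
Qed.

Lemma quad_at_flowx x0 t p0 (a b : R) :
  x0 \in `]a, b[ -> quad_at (W x0 t) (su2_of_vec p0) ->
  exists p : R -> 'cV[R]_3, p x0 = p0 /\ forall x, x \in `]a, b[ ->
    (forall k, is_derive x 1 (fun y => p y k 0) (vec_of_su2 (tangent x t) k 0)) /\
    quad_at (W x t) (su2_of_vec (p x)).
Proof.
move=> xab qx; apply: (@quad_at_flow _ (fun y => W y t) (fun y => vec_of_su2 (tangent y t))
  (fun=> 0) a b x0 p0 xab _ _ _ qx).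
- by move=> x l; rewrite (vec_of_su2K (su2_tangent x t));
    exact: (spectral_ratio_derivex x t l).
- by move=> x k; have [] := is_derive_vec_of_su2 k (tangent_derivex x t).
- by move=> x; exists 0; exact: is_mxcderive_cst.
Qed.

Lemma quad_at_flowt x t0 p0 (a b : R) :
  t0 \in `]a, b[ -> quad_at (W x t0) (su2_of_vec p0) ->
  exists p : R -> 'cV[R]_3, p t0 = p0 /\ forall t, t \in `]a, b[ ->
    (forall k, is_derive t 1 (fun y => p y k 0) (vec_of_su2 (normal x t) k 0)) /\
    quad_at (W x t) (su2_of_vec (p t)).
Proof.
move=> tab qt; apply: (@quad_at_flow _ (W x) (fun y => vec_of_su2 (normal x y))
  (tangent x) a b t0 p0 tab _ _ _ qt).
- by move=> t l; rewrite (vec_of_su2K (su2_normal x t));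
    exact: (spectral_ratio_derivet x t l).
- by move=> t k; have [D dD] := normal_derivet x t;
    have [] := is_derive_vec_of_su2 k dD.
- by move=> t; exact: (tangent_derivet x t).
Qed.

Lemma quad_at_origin : quad_at (W 0 0) (su2_of_vec 0).
Proof.
(* The frame at the origin is phi0 for every l, so W(0, 0, l) = 1 exactly and the remainder is
   zero. *)
exists 0 => l _; rewrite mul0r /W /Fa /F !hE0; have [pp _] := hphi0.
have [-> _] := unitary_mulC pp; rewrite subrr sub0r.
have -> : su2_of_vec (0 : 'cV[R]_3) = 0.
  by rewrite /su2_of_vec !mxE !scale0r !addr0.
rewrite scaler0 oppr0 -(scale0r (0 : 'M[R[i]]_2)) frob2Z.
by rewrite /sqmod /= expr0n /= addr0 mul0r.
Qed.

(** The expansion is carried from the origin along the x-axis to (x, 0), then in t to (x, t). *)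
Lemma frame_quad_at x t : exists p, quad_at (W x t) (su2_of_vec p).
Proof.
(* The open interval of radius |y| + 1 contains both 0 and y. *)
have in_ball (y : R) : y \in `](- (`|y| + 1)), (`|y| + 1)[.
  rewrite in_itv /=; apply/andP; split.
    by rewrite ltrNl (le_lt_trans (ler_norm _)) // normrN ltrDl.
  by rewrite (le_lt_trans (ler_norm _)) // ltrDl.
have in_ball0 (y : R) : 0 \in `](- (`|y| + 1)), (`|y| + 1)[.
  by rewrite in_itv /= oppr_lt0 andbb ltr_wpDl.
have [p [_ /(_ _ (in_ball x))[_ qx]]] := quad_at_flowx (in_ball0 x) quad_at_origin.
have [p' [_ /(_ _ (in_ball t))[_ qt]]] := quad_at_flowt (in_ball0 t) qx.
by exists (p' t).
Qed.

(** Unitarity gives E = W F, so the l-derivative of E at 0 is P F, and multiplying by the inverse of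
    F returns P. In particular the first-order coefficient is unique. *)
Lemma frame_alpha_of_quad_at x t P : quad_at (W x t) P ->
  derivable (E x t : R[i]^o -> 'M[R[i]]_2) 0 1 /\ frame_alpha E x t = P.
Proof.
move=> qP; have FF := frame_unitary x t; have [FF' iF] := unitary_mulC FF.
have EW : E x t = fun l => W x t l *m E x t 0.
  by apply/funext => l; rewrite /W -mulmxA FF mulmx1.
have [_ dE E'] := quad_at_derive1 qP EW.
by split=> //; rewrite /frame_alpha E' iF -mulmxA FF' mulmx1.
Qed.

Lemma frame_derivable x t : derivable (E x t : R[i]^o -> 'M[R[i]]_2) 0 1.
Proof. by have [p /frame_alpha_of_quad_at[]] := frame_quad_at x t. Qed.

Lemma su2_frame_alpha x t : su2 (frame_alpha E x t).
Proof.
by have [p /frame_alpha_of_quad_at[_ ->]] := frame_quad_at x t; exact: su2_of_vecP.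
Qed.

(** * The position map [alpha] and its equation of motion *)

Let alpha x t := vec_of_su2 (frame_alpha E x t).

Lemma alpha_of_quad_at x t p : quad_at (W x t) (su2_of_vec p) -> alpha x t = p.
Proof. by move=> /frame_alpha_of_quad_at[_ aE]; rewrite /alpha aE su2_of_vecK. Qed.

Lemma frame_alpha_quad_at x t : quad_at (W x t) (su2_of_vec (alpha x t)).
Proof. by have [p qp] := frame_quad_at x t; rewrite (alpha_of_quad_at qp). Qed.

Lemma frame_alpha_origin : alpha 0 0 = 0.
Proof. exact: alpha_of_quad_at quad_at_origin. Qed.

(** The curve p integrated from [tangent] and the map [alpha] are both the first-order coefficient
    of [W], so they agree on an interval around x and share their derivative. *)
Lemma frame_alpha_derivex (x t : R) k :
  is_derive x 1 (fun s => alpha s t k 0) (vec_of_su2 (tangent x t) k 0).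
Proof.
have xab : x \in `]x - 1, x + 1[ by rewrite in_itv /=; apply/andP; split; lra.
have [p [_ Hp]] := quad_at_flowx xab (frame_alpha_quad_at x t).
have [dp _] := Hp x xab; apply: near_eq_is_derive (dp k).
near=> y; have /Hp[_ /alpha_of_quad_at ->//] : y \in `]x - 1, x + 1[.
by near: y; exact: near_in_itvoo.
Unshelve. all: by end_near. Qed.

Lemma frame_alpha_derivet (x t : R) k :
  is_derive t 1 (fun s => alpha x s k 0) (vec_of_su2 (normal x t) k 0).
Proof.
have tab : t \in `]t - 1, t + 1[ by rewrite in_itv /=; apply/andP; split; lra.
have [p [_ Hp]] := quad_at_flowt tab (frame_alpha_quad_at x t).
have [dp _] := Hp t tab; apply: near_eq_is_derive (dp k).
near=> y; have /Hp[_ /alpha_of_quad_at ->//] : y \in `]t - 1, t + 1[.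
by near: y; exact: near_in_itvoo.
Unshelve. all: by end_near. Qed.

Lemma Ck2_vec_of_su2 n (M : R -> R -> 'M[R[i]]_2) k :
  mxCk2 n M -> Ck2 n (fun x t => vec_of_su2 (M x t) k 0).
Proof.
move=> hM; under eq_fun do under eq_fun do rewrite mxE.
have [h1 h2] := hM 0 1; have [_ h3] := hM 0 0.
by case: k => -[|[|[|//]]] ltk.
Qed.

Lemma frame_alpha_smooth (c : 'cV[R]_3) : smooth2 (fun x t => alpha x t + c).
Proof.
have cE k x : vec_of_su2 x k 0 = vec_of_su2 x k 0 + (0 : R) by rewrite addr0.
have dgx (x t : R) k : is_derive x 1 (fun s => (alpha s t + c) k 0)
    (vec_of_su2 (tangent x t) k 0).
  under eq_fun do rewrite mxE; rewrite [X in is_derive _ _ _ X]cE.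
  exact: (is_deriveD (frame_alpha_derivex x t k) (is_derive_cst _ _ _)).
have dgt (x t : R) k : is_derive t 1 (fun s => (alpha x s + c) k 0)
    (vec_of_su2 (normal x t) k 0).
  under eq_fun do rewrite mxE; rewrite [X in is_derive _ _ _ X]cE.
  exact: (is_deriveD (frame_alpha_derivet x t k) (is_derive_cst _ _ _)).
have htangent n k : Ck2 n (fun x t => vec_of_su2 (tangent x t) k 0).
  exact: (Ck2_vec_of_su2 k (mxCk2_frame_conj (mxCk2_cst n (su2_a R)))).
have hnormal n k : Ck2 n (fun x t => vec_of_su2 (normal x t) k 0).
  exact: (Ck2_vec_of_su2 k (mxCk2_frame_conj (csmooth2_lax_u n qs))).
(* One order more is proved and then dropped, so that n = 0 also goes through the partial
   derivatives; joint continuity follows from their local boundedness. *)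
move=> n; apply: Ck2_colP => k; apply: Ck2_pred.
apply: (Ck2_is_derive (fun x t => dgx x t k) (fun x t => dgt x t k)) => // z.
pose K f := `|vec_of_su2 (f z.1 z.2 : 'M[R[i]]_2) k 0| + 1.
have K0 f : 0 <= K f by rewrite addr_ge0.
apply: (@continuous_of_partials _ _ _ _ (K tangent + K normal) z
  (fun x t => dgx x t k) (fun x t => dgt x t k)).
have := continuous_near_le z (Ck2_continuous (htangent 0 k)).
have := continuous_near_le z (Ck2_continuous (hnormal 0 k)).
apply: filterS2 => w h1 h2; split.
  by apply: le_trans h2 _; rewrite lerDl K0.
by apply: le_trans h1 _; rewrite lerDr K0.
Qed.

Lemma frame_alpha_VFE (c : 'cV[R]_3) (x t : R) (gamma := fun x t => alpha x t + c) :
  dt gamma x t = 2^-1 *: cross (dx gamma x t) (dx (dx gamma) x t).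
Proof.
have dgx (y s : R) : is_derive y 1 (gamma^~ s) (vec_of_su2 (tangent y s)).
  rewrite -[vec_of_su2 _]addr0; apply: is_deriveD.
  by apply: is_derive_colP => k; exact: frame_alpha_derivex.
have dgt : is_derive t 1 (gamma x) (vec_of_su2 (normal x t)).
  rewrite -[vec_of_su2 _]addr0; apply: is_deriveD.
  by apply: is_derive_colP => k; exact: frame_alpha_derivet.
have dxE : dx gamma = fun y s => vec_of_su2 (tangent y s).
  apply/funext => y; apply/funext => s; rewrite /dx derive1E.
  by have [] := dgx y s.
pose K := lax_u q x t *m su2_a R - su2_a R *m lax_u q x t.
have dxxE : dx (dx gamma) x t = vec_of_su2 (frame_conj K x t).
  rewrite dxE /dx derive1E.
  have : is_derive x 1 (fun s => vec_of_su2 (tangent s t))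
      (vec_of_su2 (frame_conj K x t)).
    by apply: is_derive_colP => k; apply/is_derive_vec_of_su2/tangent_derivex.
  by case.
rewrite dxxE dxE /dt derive1E; have [_ ->] := dgt.
have FF := frame_unitary x t.
(* Membership in su(2) is needed because [vec_of_su2] is inverted by [su2_of_vec] only there. *)
have sK : su2 K.
  have [u1 _] := su2_lax_u q x t; have [a1 _] := @su2_su2_a R.
  split; last by rewrite /K raddfB /= mxtrace_mulC subrr.
  by rewrite /K raddfB /= map_mxB !adjmxM u1 a1 !mulNmx !mulmxN !opprK opprB.
rewrite /cross /= (vec_of_su2K (su2_tangent x t)) vec_of_su2K; last exact: su2_conj.
have conjM X Y : frame_conj X x t *m frame_conj Y x t = frame_conj (X *m Y) x t.
  by rewrite /frame_conj !mulmxA -(mulmxA _ ((E x t 0)^t*) (E x t 0)) FF mulmx1.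
have conjB X Y : frame_conj X x t - frame_conj Y x t = frame_conj (X - Y) x t.
  by rewrite /frame_conj mulmxBr mulmxBl.
rewrite /tangent !conjM conjB lax_bracket.
(* The 1/2 of the cross product turns the 4 of [lax_bracket] into 2; the 1/2 of the flow equation
   then leaves a single [normal]. *)
have -> : 2^-1 *: frame_conj (4 *: lax_u q x t) x t = normal x t + normal x t.
  rewrite /normal /frame_conj -scalemxAr -scalemxAl scalerA.
  by rewrite (_ : 2^-1 * 4 = 2) ?scaler_nat ?mulr2n //; field.
apply/colP => k; rewrite !mxE.
by case: k => -[|[|[|//]]] ltk /=; rewrite ?mxE ?ReD ?ImD; field.
Qed.

End NLSFrame.

(** * The vortex filament flow and its initial curve *)

Theorem theorem4p11 (R : realType) (gamma0 : R -> 'cV[R]_3)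
    (g0 : R -> 'M[R]_3) (r1 r2 : R -> R) (phi0 : 'M[R[i]]_2)
    (q : R -> R -> R[i]) (E : R -> R -> R[i] -> 'M[R[i]]_2)
    (hgamma0 : arclength_curve gamma0)
    (hg0 : p_frame gamma0 g0 r1 r2)
    (hphi0 : SU2 phi0)
    (hg0phi0 : g0 0 = Ad_delta phi0)
    (hq : NLS_solution q)
    (hq0 : forall x, q x 0 = 1 / 2 * (r1 x +i* r2 x))
    (hE : NLS_frame q E)
    (hE0 : forall l, E 0 0 l = phi0) :
  [/\ forall x t, derivable (E x t : R[i]^o -> 'M[R[i]]_2) 0 1,
      forall x t, su2 (frame_alpha E x t) &
      VFE_solution
        (fun x t => vec_of_su2 (frame_alpha E x t) + gamma0 0) gamma0].
Proof.
have [qs _] := hq; have [sg0 SO3g0 g0col g0M] := hg0.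
split.
- by move=> x t; exact: (frame_derivable qs hE hphi0 hE0).
- by move=> x t; exact: (su2_frame_alpha qs hE hphi0 hE0).
split.
- exact: (frame_alpha_smooth qs hE hphi0 hE0).
- by move=> x t; exact: (frame_alpha_VFE qs hE hphi0 hE0).
have Ad x : g0 x = Ad_delta (E x 0 0).
  apply: (@Ad_delta_p_frame _ (fun y => E y 0 0) q g0 r1 r2) => //.
  - by move=> y; exact: (frame_unitary hE y 0).
  - by move=> y; exact: (frame0_derivex hE y 0).
  - by move=> y; exact: (sg0 0%N).
  - by move=> y; have [] := SO3g0 y.
  - by rewrite hE0.
have [sgamma _] := hgamma0.
(* The first entry of [delta] is [a], so the first column of the common frame, which is the
   derivative of gamma0, is the conjugate of [a] by the frame. *)
have dgamma (x : R) k : is_derive x 1 (fun s => gamma0 s k 0)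
    (vec_of_su2 (frame_conj E (su2_a R) x 0) k 0).
  have -> : vec_of_su2 (frame_conj E (su2_a R) x 0) k 0 = derive1 gamma0 x k 0.
    have [_ iF] := unitary_mulC (frame_unitary hE x 0).
    by rewrite -g0col [RHS]mxE Ad [RHS]mxE iF.
  have dg : derivable gamma0 x 1 := sgamma 0%N x.
  rewrite derive1E derive_mx // mxE; apply: derivableP.
  by have /derivable_mxP := dg; apply.
move=> x; apply/colP => k; rewrite mxE; apply/subr0_eq; rewrite addrAC.
(* At t = 0 the map [alpha] and gamma0 have the same derivative, so their difference keeps its value
   -gamma0(0) at the origin, which the added constant cancels. *)
have d0 (y : R) : is_derive y 1
    (fun s => vec_of_su2 (frame_alpha E s 0) k 0 - gamma0 s k 0) 0.
  rewrite -[X in is_derive _ _ _ X](subrr (vec_of_su2 (frame_conj E (su2_a R) y 0) k 0)).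
  have dpos : is_derive y 1 (fun s => vec_of_su2 (frame_alpha E s 0) k 0)
    (vec_of_su2 (frame_conj E (su2_a R) y 0) k 0).
    exact: (frame_alpha_derivex qs hE hphi0 hE0).
  exact: (is_deriveB dpos (dgamma y k)).
rewrite (is_derive_0_is_cst x 0 d0).
have -> : vec_of_su2 (frame_alpha E 0 0) = 0 := frame_alpha_origin hE hphi0 hE0.
by rewrite [(0 : 'cV_3) k 0]mxE sub0r addNr.
Qed.
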